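(* Let $K$ be a cubical mesh in $\Omega\subset\mathbb{R}^n$, let $k\ge1$, and let $K_k$ be the refinement of $K$ whose cells are the $k$th order small cubes. For each $0\le p\le n$, the interpolation operator $\mathfrak{I}:C_p^*(K_k)\to Q_k^p(K)$ is well defined by the requirement $$\int_{\upsilon}\mathfrak{I}X=X(\upsilon)\quad\text{for all }\upsilon\in S^p(K_k),$$ that is, for every $X\in C_p^*(K_k)$ there is exactly one element $\mathfrak{I}X\in Q_k^p(K)$ satisfying it. Moreover, it satisfies $$\mathcal{C}_k\mathfrak{I}X=X\quad\forall X\in C_p^*(K_k),$$ $$\mathfrak{I}\mathcal{C}_k\omega=\omega\quad\forall\omega\in Q_k^p(K),$$ $$\mathfrak{I}\,\mathrm{d}X=\mathrm{d}\,\mathfrak{I}X\quad\forall X\in C_p^*(K_k).$$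
   Context: Unit cube. $\square^n=[0,1]^n$. $\mathcal{J}(n,k-1)$ is the set of multi-indices $\mathbf{k}=(k_1,\ldots,k_n)$ of integers with $0\le k_i\le k-1$, and $\mathbf{k}_{k-1}:\square^n\to\square^n$ is $\mathbf{k}_{k-1}(x)=\frac{1}{k}(k_1+x_1,\ldots,k_n+x_n)$. The $k$th order small $p$-cubes of $\square^n$ are the sets $\mathbf{k}_{k-1}(\tau)$ with $\mathbf{k}\in\mathcal{J}(n,k-1)$ and $\tau$ a $p$-face of $\square^n$. For a $p$-face $\tau$ let $x_{i_1},\ldots,x_{i_p}$ ($i_1<\ldots<i_p$) be the coordinates whose plane is parallel to $\tau$ and $x_{i_{p+1}},\ldots,x_{i_n}$ the others, with constant values $y_{i_j}\in\{0,1\}$ on $\tau$; put $$\mathcal{W}\tau=\Big(\prod_{j=p+1}^n x_{i_j}^{y_{i_j}}(1-x_{i_j})^{1-y_{i_j}}\Big)\mathrm{d}x_{i_1}\wedge\ldots\wedge \mathrm{d}x_{i_p},\qquad w(\mathbf{k}_{k-1}(\tau))=\Big(\prod_{i=1}^n x_i^{k_i}(1-x_i)^{k-1-k_i}\Big)\mathcal{W}\tau .$$ Meshes. A mesh $K$ in $\Omega$ is a finite cell complex with union $\Omega$, in which every cell is a face of some $n$-cell and two cells meet in a common face or not at all. It is cubical if for each $n$-cell $\sigma$ of $K$ there is an affine bijection $\phi:\square^n\to\sigma$ (so $\sigma$ is a parallelotope). All cells are given fixed orientations. $S^p(K)$ is the set of $p$-cells and $C_p^*(K)$ the space of real $p$-cochains;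 likewise for $K_k$. Small cubes and forms on $K$. The $k$th order small cubes of an $n$-cell $\sigma$ are the images under $\phi$ of those of $\square^n$, and the corresponding cubical forms in $\sigma$ are the pullbacks $w(\phi(\mathbf{k}_{k-1}(\tau)))=(\phi^{-1})^*(w(\mathbf{k}_{k-1}(\tau)))$. $K_k$ is the cubical mesh whose cells are all the $k$th order small cubes (of all dimensions) of the cells of $K$. For $\upsilon\in S^p(K_k)$, $w(\upsilon)$ denotes the piecewise smooth $p$-form on $\Omega$ which on each $n$-cell $\sigma$ containing $\upsilon$ is the cubical form of $\upsilon$ regarded as a small cube of $\sigma$, with sign chosen so that its integral over the oriented cell $\upsilon$ is positive, and which is zero on the $n$-cells not containing $\upsilon$; the traces from neighbouring $n$-cells on common faces agree. $Q_k^p(K)$, the space of $k$th order cubical $p$-forms, is the real span of all $w(\upsilon)$, $\upsilon\in S^p(K_k)$; $Q_k^{n+1}(K)=0$. Operators. $\mathcal{C}_k$ is the de Rham map of $K_k$: $(\mathcal{C}_k\omega)(\upsilon)=\int_\upsilon\omega$ for $\upsilon\in S^p(K_k)$ (the integral being of the single-valued trace). $\mathrm{d}$ denotes both the coboundary operator $C_p^*(K_k)\to C_{p+1}^*(K_k)$ and the exterior derivative, taken on each $n$-cell. The operator $\mathfrak{I}$ is used in every degree. *)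

(* Defs.v *)
From HB Require Import structures.
From mathcomp Require Import all_boot all_order all_algebra.
From mathcomp Require Import all_classical all_reals all_analysis.

Set Implicit Arguments.
Unset Strict Implicit.
Unset Printing Implicit Defensive.

Import Order.TTheory GRing.Theory Num.Theory.
Import numFieldNormedType.Exports.

Local Open Scope classical_set_scope.
Local Open Scope ring_scope.

Definition unit_cube (R : realType) (n : nat) : set 'rV[R]_n :=
  [set x | forall j, 0 <= x 0 j <= 1].
Arguments unit_cube : clear implicits.

Section UnitCube.
Variables (R : realType) (n : nat).

(* A face of [0,1]^n: [tau j = Some y] means that x_j is constantly y on the
   face, [tau j = None] that x_j varies in [0,1]. *)
Definition cface := {ffun 'I_n -> option bool}.

Definition face_set (tau : cface) : set 'rV[R]_n :=
  [set x | forall j, match tau j with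
                     | Some y => x 0 j = y%:R
                     | None => 0 <= x 0 j <= 1
                     end].

Definition free_coords (tau : cface) : {set 'I_n} :=
  [set j | tau j == None]%SET.

Definition pface (p : nat) := {tau : cface | #|free_coords tau| == p}.

(* i_1 < ... < i_p; [enum_val] lists a set of ordinals in increasing order. *)
Definition free_coord p (tau : pface p) (b : 'I_p) : 'I_n :=
  enum_val (cast_ord (esym (eqP (valP tau))) b).

(* A p-form evaluated at a point and at p vectors, the rows of a p x n matrix.
   No alternation is built in: it holds for all the forms considered below. *)
Definition pform (p : nat) := 'rV[R]_n -> 'M[R]_(p, n) -> R.

(* dx_{i_1} /\ ... /\ dx_{i_p} on (v_1, ..., v_p) is det (v_a)_{i_b}. *)
Definition whitney_form p (tau : pface p) : pform p := fun x v =>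
  (\prod_(j < n) if val tau j is Some y
                 then x 0 j ^+ y * (1 - x 0 j) ^+ (~~ y) else 1)
  * \det (colsub (free_coord tau) v).

Definition small_map (k : nat) (kk : {ffun 'I_n -> 'I_k}) (x : 'rV[R]_n) :
  'rV[R]_n := \row_j (k%:R^-1 * ((kk j)%:R + x 0 j)).

Definition small_index (k p : nat) : Type :=
  ({ffun 'I_n -> 'I_k} * pface p)%type.

Definition small_cube k p (c : small_index k p) : set 'rV[R]_n :=
  small_map c.1 @` face_set (val c.2).

Definition cube_form k p (c : small_index k p) : pform p := fun x v =>
  (\prod_(j < n) (x 0 j ^+ c.1 j * (1 - x 0 j) ^+ (k.-1 - c.1 j)))
  * whitney_form c.2 x v.

Definition affine_map (A : 'M[R]_n) (b x : 'rV[R]_n) : 'rV[R]_n := x *m A + b.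

(* (phi^-1)^* w for phi = affine_map A b with A invertible. *)
Definition pullback_inv (A : 'M[R]_n) (b : 'rV[R]_n) p (w : pform p) : pform p :=
  fun x v => w ((x - b) *m invmx A) (v *m invmx A).

Definition exterior_derivative p (w : pform p) : pform p.+1 := fun x v =>
  \sum_(i < p.+1) (-1) ^+ i * 'D_(row i v) (fun y => w y (row' i v)) x.

(* An oriented p-dimensional parallelotope u: a parametrization
   t |-> a + t_1 v_1 + ... + t_p v_p of u by [0,1]^p, oriented by the frame
   (v_1, ..., v_p) if [osign] is false, oppositely if it is true.  The sign is
   needed only for points, which have a single frame but two orientations. *)
Record oriented_cell (p : nat) (u : set 'rV[R]_n) := OrientedCell {
  obase : 'rV[R]_n;
  oframe : 'M[R]_(p, n);
  osign : bool;
  _ : u = (fun t : 'rV[R]_p => obase + t *m oframe) @` unit_cube R p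
}.

End UnitCube.

Arguments face_set R {n} tau.
Arguments small_cube R {n k p} c.
Arguments cube_form R {n k p} c.

Fixpoint cube_integral (R : realType) (p : nat) : ('rV[R]_p -> R) -> R :=
  match p return ('rV[R]_p -> R) -> R with
  | 0%N => fun f => f 0
  | q.+1 => fun f =>
      \int[@lebesgue_measure R]_(t in `[0, 1])
        cube_integral (fun s : 'rV[R]_q => f (row_mx (t%:M : 'M[R]_1) s))
  end.

Definition cell_integral (R : realType) (n p : nat) (u : set 'rV[R]_n)
    (o : oriented_cell p u) (w : pform R n p) : R :=
  (-1) ^+ osign o *
  cube_integral (fun t : 'rV[R]_p => w (obase o + t *m oframe o) (oframe o)).

Definition image_face (R : realType) (n : nat) (A : 'M[R]_n) (b : 'rV[R]_n)
  (tau : cface n) : set 'rV[R]_n := affine_map A b @` face_set R tau.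

Definition image_cube (R : realType) (n : nat) (A : 'M[R]_n) (b : 'rV[R]_n) :
  set 'rV[R]_n := affine_map A b @` unit_cube R n.

(* Indexed by its n-cells; the cells are all the faces of the n-cells. *)
Record cubical_mesh (R : realType) (n : nat) (Omega : set 'rV[R]_n) := CubicalMesh {
  mcells : finType;
  mlin : mcells -> 'M[R]_n;
  mtrans : mcells -> 'rV[R]_n;
  mlin_unit : forall i, mlin i \in unitmx;
  mcell_inj : injective (fun i => image_cube (mlin i) (mtrans i));
  mesh_cover : Omega = \bigcup_i image_cube (mlin i) (mtrans i);
  mesh_meet : forall i j (tau tau' : cface n),
    let c := image_face (mlin i) (mtrans i) tau in
    let c' := image_face (mlin j) (mtrans j) tau' in
    c `&` c' = set0 \/
    (exists rho, face_set R rho `<=` face_set R tau /\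
                 c `&` c' = image_face (mlin i) (mtrans i) rho) /\
    (exists rho', face_set R rho' `<=` face_set R tau' /\
                  c `&` c' = image_face (mlin j) (mtrans j) rho')
}.

Definition mcell (R : realType) (n : nat) (Omega : set 'rV[R]_n)
  (K : cubical_mesh Omega) (i : mcells K) : set 'rV[R]_n :=
  image_cube (mlin i) (mtrans i).

Section Refinement.
Variables (R : realType) (n : nat) (Omega : set 'rV[R]_n).
Variables (K : cubical_mesh Omega) (k : nat).

Definition msmall_cube (i : mcells K) p (c : small_index n k p) : set 'rV[R]_n :=
  affine_map (mlin i) (mtrans i) @` small_cube R c.

(* Distinct indices (i, c) may give the same cell. *)
Definition Kk_cells (p : nat) : set (set 'rV[R]_n) :=
  [set u | exists i (c : small_index n k p), u = msmall_cube i c].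

Definition cochain (p : nat) : Type := Kk_cells p -> R.

Definition orientation : Type :=
  forall p (u : Kk_cells p), oriented_cell p (val u).

(* Piecewise forms: one form for each n-cell, given by an extension to R^n, so
   that it can be differentiated at boundary points.  For the forms considered
   here the extension is polynomial, hence determined by the values on the
   n-cell, and equality of extensions amounts to equality on the n-cells. *)
Definition pwform (p : nat) : Type := mcells K -> pform R n p.

Definition pw_derivative p (w : pwform p) : pwform p.+1 :=
  fun i => exterior_derivative (w i).

Variable o : orientation.

(* A cell u of K_k is contained in the n-cell i if and only if
   it is one of the small cubes of i, and the form does not depend on the index
   c by which it is such. *)
Definition w_form p (u : Kk_cells p) : pwform p := fun i x v =>
  if [pick c : small_index n k p | `[< val u = msmall_cube i c >]] is Some c then
    let w := pullback_inv (mlin i) (mtrans i) (cube_form R c) in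
    Num.sg (cell_integral (o u) w) * w x v
  else 0.

Definition cubical_forms (p : nat) : set (pwform p) :=
  [set w | exists (s : seq (Kk_cells p)) (a : Kk_cells p -> R),
     w = fun i x v => \sum_(u <- s) a u * w_form u i x v].

(* The integral over u uses the trace from some n-cell containing u; for forms
   in [cubical_forms] the traces from all such n-cells agree. *)
Definition de_Rham p (w : pwform p) : cochain p := fun u =>
  if [pick i : mcells K | `[< val u `<=` mcell i >]] is Some i
  then cell_integral (o u) (w i) else 0.

(* The facet t_i = b of an oriented cell. *)
Definition facet p (u : set 'rV[R]_n) (ou : oriented_cell p.+1 u)
    (i : 'I_p.+1) (b : bool) : set 'rV[R]_n :=
  (fun t : 'rV[R]_p.+1 => obase ou + t *m oframe ou) @`
    [set t : 'rV[R]_p.+1 | t 0 i = b%:R /\ unit_cube R p.+1 t].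

(* Sign comparing the orientation of u with the frame formed by the outward
   normal vector of the facet t_i = b followed by the frame of u'. *)
Definition facet_sign p (u u' : set 'rV[R]_n) (ou : oriented_cell p.+1 u)
    (ou' : oriented_cell p u') (i : 'I_p.+1) (b : bool) : R :=
  (-1) ^+ osign ou * (-1) ^+ osign ou' *
  Num.sg (\det ((col_mx ((-1) ^+ (~~ b) *: row i (oframe ou)) (oframe ou')
                  : 'M[R]_(p.+1, n)) *m pinvmx (oframe ou))).

(* Incidence number [u : u'], 0 if u' is not a facet of u. *)
Definition incidence p (u : Kk_cells p.+1) (u' : Kk_cells p) : R :=
  \sum_(i < p.+1) \sum_(b : bool)
    if `[< val u' = facet (o u) i b >] then facet_sign (o u) (o u') i b else 0.

Definition coboundary p (X : cochain p) : cochain p.+1 := fun u =>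
  \sum_(u' \in [set: Kk_cells p]) incidence u u' * X u'.

Definition interpolation p (X : cochain p) : pwform p :=
  xget (fun _ _ _ => 0 : R) [set w | cubical_forms w /\ forall u, de_Rham w u = X u].

End Refinement.

(* Main.v *)
From HB Require Import structures.
Require Import Defs.
From mathcomp Require Import all_boot all_order all_algebra all_fingroup.
From mathcomp Require Import all_classical all_reals all_analysis.
From mathcomp Require Import ring lra zify.

Set Implicit Arguments.
Unset Strict Implicit.
Unset Printing Implicit Defensive.

Import Order.TTheory GRing.Theory Num.Theory.
Import numFieldNormedType.Exports.

Local Open Scope classical_set_scope.
Local Open Scope ring_scope.

(** On one n-cell everything is a tensor product.  In each coordinate a small
    cube is a point m/k or an interval [m/k,(m+1)/k], both of the shape
    [lo/k, 1 - hi/k], and its form contributes the Bernstein polynomial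
    x^lo (1 - x)^hi, of degree k for a point and k - 1 for an interval.  The
    integral of the form of one small cube over another one is, up to a nonzero
    factor, a product of one-dimensional pairings ([cell_integral_cube_form]).
    The one-dimensional pairing is invertible: a polynomial of degree at most k is
    determined by its values at the k + 1 points, and one of degree at most k - 1
    by its integrals over the k intervals, since its primitive is then known at
    the k + 1 points ([pairing_dual]).  Hence so is the tensor product: a
    combination of cubical forms of one n-cell whose integrals over all small
    cubes vanish has zero coefficients ([cube_form_coef]).

    To pass to the mesh, the integral over a cell must not depend on the n-cell
    whose trace is used.  Two n-cells meet in a common face, and the transition
    between their coordinates on that face is an affine bijection between faces
    of cubes.  Such a map sends vertices to vertices, hence permutes and reflects
    coordinates ([face_transition]).  A reflection exchanges lo and hi, so small
    cubes and, up to sign, their forms correspond on the common face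
    ([form_transition]); the sign disappears when the integral over the small
    cube is required to be positive.  Forms of small cubes outside the face have
    zero trace on it ([cube_form_vanish]).  This gives [w_form_trace].

    Uniqueness now holds on each n-cell separately.  For existence, the matrix of
    integrals of the w(u), indexed by the cells of the refinement on both sides,
    is square, and it has trivial kernel because each cell lies in some n-cell,
    where local unisolvence applies ([w_form_indep]).

    For the derivative, the exterior derivative of a cubical form is, on each
    n-cell, a combination of cubical forms, because the derivative of a Bernstein
    polynomial of degree k is a combination of two of degree k - 1
    ([exterior_cube_form]).  By Stokes' theorem for polynomial forms on
    parallelotopes ([stokes]) it has the same integrals as the interpolant of the
    coboundary, so the two agree on each n-cell by local uniqueness.

    All integrands are polynomial, so that the iterated integrals, partial
    derivatives and changes of parametrization are computed on sums of products
    of one-variable polynomials ([separable]). *)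

(** * Integrals of polynomials in one variable *)

Section Primitive.
Variable R : realType.
Implicit Types P Q : {poly R}.

Definition primitive P : {poly R} := \poly_(i < (size P).+1) (P`_i.-1 / i%:R).

Lemma coef_primitive P i : (primitive P)`_i = P`_i.-1 / i%:R.
Proof.
rewrite coef_poly; case: ltnP => // Pi.
by rewrite nth_default ?mul0r//; case: i Pi.
Qed.

Lemma deriv_primitive P : (primitive P)^`() = P.
Proof.
apply/polyP => i; rewrite coef_deriv coef_primitive -[LHS]mulr_natr -mulrA.
by rewrite mulVf ?mulr1// pnatr_eq0.
Qed.

(** Through the primitive rather than as an integral, so that linearity needs no
    integrability. *)
Definition poly_integral P : R := (primitive P).[1] - (primitive P).[0].

Lemma poly_integral_is_linear : linear poly_integral.
Proof.
move=> a P Q; rewrite /poly_integral.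
have -> : primitive (a *: P + Q) = a *: primitive P + primitive Q.
  by apply/polyP => i; rewrite !(coefD, coefZ, coef_primitive) mulrDl mulrA.
by rewrite !hornerD !hornerZ -[a *: _]/(a * _); ring.
Qed.
HB.instance Definition _ :=
  GRing.isLinear.Build R {poly R} R _ poly_integral poly_integral_is_linear.

Lemma Rintegral_deriv P :
  \int[@lebesgue_measure R]_(t in `[0, 1]) (P^`()).[t] = P.[1] - P.[0].
Proof.
rewrite /Rintegral (@continuous_FTC2 _ _ (horner P) 0 1) //.
- by apply: continuous_subspaceT => x; exact: continuous_horner.
- split.
  + by move=> x _; exact: derivable_horner.
  + by apply: cvg_at_right_filter; exact: continuous_horner.
  + by apply: cvg_at_left_filter; exact: continuous_horner.
- by move=> x _; rewrite -derivE.
Qed.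

Lemma RintegralE P :
  \int[@lebesgue_measure R]_(t in `[0, 1]) P.[t] = poly_integral P.
Proof. by rewrite -{1}(deriv_primitive P) Rintegral_deriv. Qed.

Lemma poly_integral_deriv P : poly_integral P^`() = P.[1] - P.[0].
Proof. by rewrite -RintegralE Rintegral_deriv. Qed.

Definition flip_poly (e : bool) : {poly R} := if e then 1 - 'X else 'X.

Lemma poly_integral_flip e P : poly_integral (P \Po flip_poly e) = poly_integral P.
Proof.
case: e; last by rewrite /= comp_polyXr.
have -> : P \Po (1 - 'X) = (- (primitive P \Po (1 - 'X)))^`().
  rewrite derivN deriv_comp deriv_primitive derivB derivX.
  by rewrite -polyC1 derivC sub0r mulrN1 opprK.
rewrite poly_integral_deriv !hornerN !horner_comp !hornerE /poly_integral.
by rewrite subrr subr0 opprK addrC.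
Qed.

Lemma poly_integral_gt0 P :
  (forall t, 0 < t < 1 -> 0 < P.[t]) -> 0 < poly_integral P.
Proof.
move=> P_gt0; rewrite /poly_integral.
have [|x _||c c01 ->] := @MVT R (horner (primitive P)) (horner P) 0 1 => //.
- apply: DeriveDef; first exact: derivable_horner.
  by rewrite -derive1E -derivE deriv_primitive.
- by apply: continuous_subspaceT => x; exact: continuous_horner.
- by rewrite subr0 mulr1; apply: P_gt0; rewrite in_itv in c01.
Qed.

End Primitive.

(** * Polynomial functions of several variables *)

Section Polyfun.
Variable R : realType.

(** Products of one-variable polynomials rather than monomials: the reflections
    t_b -> 1 - t_b, the partial derivatives and the iterated integrals then act
    factor by factor. *)
Definition separable n (s : seq (R * ('I_n -> {poly R}))) : 'rV[R]_n -> R :=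
  fun x => \sum_(q <- s) q.1 * \prod_j (q.2 j).[x 0 j].

Definition polyfun n (f : 'rV[R]_n -> R) : Prop :=
  exists s, f = separable s.

Variable n : nat.
Implicit Types f g : 'rV[R]_n -> R.

Lemma polyfun_cst c : polyfun (fun _ : 'rV[R]_n => c).
Proof.
exists [:: (c, fun _ => 1)]; apply/funext => x; rewrite /separable big_seq1 /=.
by rewrite big1 ?mulr1// => j _; rewrite hornerE.
Qed.

Lemma polyfun_horner (P : {poly R}) j : polyfun (fun x : 'rV[R]_n => P.[x 0 j]).
Proof.
exists [:: (1, fun i => if i == j then P else 1)]; apply/funext => x.
rewrite /separable big_seq1 /= mul1r (bigD1 j)//= eqxx big1 ?mulr1// => i ij.
by rewrite (negPf ij) hornerE.
Qed.

Lemma polyfunD f g : polyfun f -> polyfun g -> polyfun (fun x => f x + g x).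
Proof.
move=> [s ->] [s' ->]; exists (s ++ s'); apply/funext => x.
by rewrite /separable big_cat.
Qed.

Lemma polyfunM f g : polyfun f -> polyfun g -> polyfun (fun x => f x * g x).
Proof.
move=> [s ->] [s' ->].
exists [seq (q.1 * r.1, fun j => q.2 j * r.2 j) | q <- s, r <- s'].
apply/funext => x; rewrite /separable big_allpairs_dep mulr_suml.
apply: eq_bigr => q _; rewrite mulr_sumr; apply: eq_bigr => r _ /=.
by rewrite mulrACA -big_split; under [in RHS]eq_bigr do rewrite hornerM.
Qed.

Lemma polyfun_sum (I : Type) (r : seq I) (F : I -> 'rV[R]_n -> R) :
  (forall i, polyfun (F i)) -> polyfun (fun x => \sum_(i <- r) F i x).
Proof.
move=> pF; elim: r => [|i r IH].
  by under eq_fun do rewrite big_nil; exact: polyfun_cst.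
by under eq_fun do rewrite big_cons; exact: polyfunD.
Qed.

Lemma polyfun_prod (I : Type) (r : seq I) (F : I -> 'rV[R]_n -> R) :
  (forall i, polyfun (F i)) -> polyfun (fun x => \prod_(i <- r) F i x).
Proof.
move=> pF; elim: r => [|i r IH].
  by under eq_fun do rewrite big_nil; exact: polyfun_cst.
by under eq_fun do rewrite big_cons; exact: polyfunM.
Qed.

Lemma polyfun_horner_comp (P : {poly R}) f :
  polyfun f -> polyfun (fun x => P.[f x]).
Proof.
move=> pf; under eq_fun do rewrite horner_coef.
apply: polyfun_sum => i; apply: polyfunM; first exact: polyfun_cst.
elim: (nat_of_ord i) => [|m IH]; first exact: polyfun_cst.
by under eq_fun do rewrite exprS; exact: polyfunM.
Qed.

End Polyfun.

Lemma polyfun_affine (R : realType) n p (f : 'rV[R]_n -> R) a (F : 'M[R]_(p, n)) :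
  polyfun f -> polyfun (fun t => f (a + t *m F)).
Proof.
move=> [s ->]; apply: polyfun_sum => q; apply: polyfunM; first exact: polyfun_cst.
apply: polyfun_prod => j; apply: polyfun_horner_comp.
under eq_fun do rewrite !mxE; apply: polyfunD; first exact: polyfun_cst.
apply: polyfun_sum => b; apply: polyfunM; last exact: polyfun_cst.
by under eq_fun do rewrite -[_ 0 b]hornerX; exact: polyfun_horner.
Qed.

(** * Integrals over the unit cube *)

Section CubeIntegral.
Variable R : realType.

Lemma cube_integral_ext p (f g : 'rV[R]_p -> R) :
  (forall t, unit_cube R p t -> f t = g t) -> cube_integral f = cube_integral g.
Proof.
elim: p f g => [|p IH] f g fg /=; first by apply: fg => -[].
apply: eq_Rintegral => t; rewrite inE/= in_itv/= => t01.
apply: IH => s s01; apply: fg => j.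
rewrite mxE; case: splitP => i _; last exact: s01.
by rewrite mxE ord1 eqxx mulr1n.
Qed.

Lemma cube_integral_separable p (s : seq (R * ('I_p -> {poly R}))) :
  cube_integral (separable s)
  = \sum_(q <- s) q.1 * \prod_j poly_integral (q.2 j).
Proof.
elim: p s => [|p IH] s /=.
  by apply: eq_bigr => q _; rewrite !big_ord0.
pose s' t := [seq (q.1 * (q.2 ord0).[t], fun j : 'I_p => q.2 (lift ord0 j))
             | q : R * ('I_p.+1 -> {poly R}) <- s].
transitivity (\int[@lebesgue_measure R]_(t in `[0, 1])
   (\sum_(q <- s) (q.1 * \prod_j poly_integral (q.2 (lift ord0 j)))
      *: q.2 ord0).[t]); last first.
  rewrite RintegralE linear_sum; apply: eq_bigr => q _.
  by rewrite linearZ /= big_ord_recl (mulrC (poly_integral _)) mulrA.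
apply: eq_Rintegral => t _.
transitivity (cube_integral (separable (s' t))).
  congr cube_integral; apply/funext => x; rewrite /separable big_map.
  apply: eq_bigr => q _; rewrite big_ord_recl mulrA /=; congr (_ * horner _ _ * _).
    rewrite mxE; case: splitP => [i _|i /esym/eqP]; last by rewrite addn_eq0.
    by rewrite mxE ord1 eqxx mulr1n.
  apply: eq_bigr => j _; congr (horner _ _).
  rewrite mxE; case: splitP => [i|i]; first by rewrite ord1.
  by rewrite /= /bump add1n => -[/val_inj ->].
rewrite IH big_map horner_sum; apply: eq_bigr => q _.
by rewrite hornerZ /= mulrAC.
Qed.

Lemma cube_integralD p (f g : 'rV[R]_p -> R) : polyfun f -> polyfun g ->
  cube_integral (fun t => f t + g t) = cube_integral f + cube_integral g.
Proof.
move=> [s ->] [s' ->]; rewrite !cube_integral_separable -big_cat.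
rewrite -cube_integral_separable; congr cube_integral; apply/funext => x.
by rewrite /separable big_cat.
Qed.

Lemma cube_integralZ p c (f : 'rV[R]_p -> R) : polyfun f ->
  cube_integral (fun t => c * f t) = c * cube_integral f.
Proof.
move=> [s ->]; pose s' := [seq (c * q.1, q.2) | q <- s].
transitivity (cube_integral (separable s')).
  congr cube_integral; apply/funext => x; rewrite /separable big_map mulr_sumr.
  by apply: eq_bigr => q _; rewrite mulrA.
rewrite !cube_integral_separable big_map mulr_sumr.
by apply: eq_bigr => q _; rewrite mulrA.
Qed.

Lemma cube_integral_sum p (I : Type) (r : seq I) (F : I -> 'rV[R]_p -> R) :
  (forall i, polyfun (F i)) ->
  cube_integral (fun t => \sum_(i <- r) F i t) = \sum_(i <- r) cube_integral (F i).
Proof.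
move=> pF; elim: r => [|i r IH].
  transitivity (0 * cube_integral (fun _ : 'rV[R]_p => 0)).
    rewrite -cube_integralZ; last exact: polyfun_cst.
    by congr cube_integral; apply/funext => x; rewrite big_nil mul0r.
  by rewrite mul0r big_nil.
rewrite big_cons -IH -cube_integralD//; last exact: polyfun_sum.
by congr cube_integral; apply/funext => x; rewrite big_cons.
Qed.

Lemma cube_integral_prod p c (P : 'I_p -> {poly R}) :
  cube_integral (fun t => c * \prod_j (P j).[t 0 j])
  = c * \prod_j poly_integral (P j).
Proof.
have := cube_integral_separable [:: (c, P)]; rewrite big_seq1 /= => <-.
by congr cube_integral; apply/funext => x; rewrite /separable big_seq1.
Qed.

Definition flip (e : bool) (t : R) := if e then 1 - t else t.

Lemma horner_flip e t : (flip_poly R e).[t] = flip e t.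
Proof. by case: e; rewrite !hornerE. Qed.

(** Permutations and reflections of the coordinates preserve the cube and its
    volume: they permute the factors of a product of one-variable integrals. *)
Lemma cube_integral_perm p (f : 'rV[R]_p -> R) (g : {perm 'I_p}) (e : 'I_p -> bool) :
  polyfun f ->
  cube_integral (fun t => f (\row_b flip (e b) (t 0 (g b)))) = cube_integral f.
Proof.
move=> [s ->].
pose s' := [seq (q.1, fun b => q.2 ((g^-1)%g b) \Po flip_poly R (e ((g^-1)%g b)))
           | q : R * ('I_p -> {poly R}) <- s].
transitivity (cube_integral (separable s')).
  congr cube_integral; apply/funext => x; rewrite /separable big_map.
  apply: eq_bigr => q _; congr (_ * _).
  rewrite [RHS](reindex_inj (@perm_inj _ g)) /=; apply: eq_bigr => b _.
  by rewrite permK mxE horner_comp horner_flip.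
rewrite !cube_integral_separable big_map; apply: eq_bigr => q _; congr (_ * _).
rewrite (reindex_inj (@perm_inj _ g)) /=; apply: eq_bigr => b _.
by rewrite permK poly_integral_flip.
Qed.

(** A directional derivative only sees the restriction to a line, so that along
    a line where the function is polynomial it is a formal derivative. *)
Lemma derive_line n (f : 'rV[R]_n -> R) x v (q : {poly R}) :
  (forall h, f (h *: v + x) = q.[h]) -> 'D_v f x = (q^`()).[0].
Proof.
move=> fq; rewrite derivE derive1E /derive.
have fx : f x = q.[0] by rewrite -fq scale0r add0r.
suff -> : (fun h => h^-1 *: ((f \o shift x) (h *: v) - f x))
  = (fun h => h^-1 *: ((horner q \o shift 0) (h *: 1) - q.[0])) by [].
by apply/funext => h /=; rewrite fq fx [h *: 1]mulr1 addr0.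
Qed.

Definition insert_coord p (i : 'I_p.+1) (c : R) (t : 'rV[R]_p) : 'rV[R]_p.+1 :=
  \row_j if unlift i j is Some j' then t 0 j' else c.

(** The fundamental theorem of calculus in the coordinate [i] of the cube. *)
Lemma cube_integral_partial p (f : 'rV[R]_p.+1 -> R) i : polyfun f ->
  polyfun (fun t => 'D_(delta_mx 0 i) f t) /\
  cube_integral (fun t => 'D_(delta_mx 0 i) f t)
  = cube_integral (fun t => f (insert_coord i 1 t))
    - cube_integral (fun t => f (insert_coord i 0 t)).
Proof.
move=> [s ->].
pose s' := [seq (q.1, fun j => if j == i then (q.2 j)^`() else q.2 j)
           | q : R * ('I_p.+1 -> {poly R}) <- s].
have Df : (fun t => 'D_(delta_mx 0 i) (separable s) t) = separable s'.
  apply/funext => t.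
  rewrite (derive_line (q := \sum_(q <- s)
     (q.1 * \prod_(j < p) (q.2 (lift i j)).[t 0 (lift i j)])
       *: (q.2 i \Po ('X + (t 0 i)%:P)))); last first.
    move=> h; rewrite horner_sum; apply: eq_bigr => q _.
    rewrite (bigD1_ord i) //= hornerZ horner_comp hornerD hornerX hornerC !mxE !eqxx.
    rewrite mulr1 (mulrC (horner _ _)) mulrA; congr (_ * _ * _).
    apply: eq_bigr => j _; rewrite !mxE [lift i j == i]eq_sym.
    by rewrite (negPf (neq_lift i j)) mulr0 add0r.
  rewrite /separable big_map raddf_sum horner_sum; apply: eq_bigr => q _ /=.
  rewrite derivZ hornerZ deriv_comp derivD derivX derivC addr0 mulr1.
  rewrite horner_comp hornerD hornerX hornerC add0r (bigD1_ord i) //= eqxx.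
  rewrite (mulrC (horner _ _)) mulrA; congr (_ * _ * _).
  apply: eq_bigr => j _; rewrite [lift i j == i]eq_sym.
  by rewrite (negPf (neq_lift i j)).
split; first by rewrite Df; exists s'.
rewrite Df cube_integral_separable big_map.
pose face c := [seq (q.1 * (q.2 i).[c], fun j => q.2 (lift i j))
               | q : R * ('I_p.+1 -> {poly R}) <- s].
have faceE c : (fun t => separable s (insert_coord i c t)) = separable (face c).
  apply/funext => t; rewrite /separable big_map; apply: eq_bigr => q _ /=.
  rewrite (bigD1_ord i) //= !mxE unlift_none mulrA; congr (_ * _).
  by apply: eq_bigr => j _; rewrite mxE liftK.
rewrite !faceE !cube_integral_separable !big_map -sumrB.
apply: eq_bigr => q _ /=; rewrite (bigD1_ord i) //= eqxx poly_integral_deriv.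
rewrite -!mulrA -mulrBr -mulrBl; congr (_ * (_ * _)).
apply: eq_bigr => j _; rewrite [lift i j == i]eq_sym.
by rewrite (negPf (neq_lift i j)).
Qed.

End CubeIntegral.

(** * Unisolvence in one variable *)

Section SmallCells.
Variables (R : realType) (k : nat).

(** The small cells of [0,1]: [inl m] is the point m/k and [inr m] the interval
    [m/k,(m+1)/k]. *)
Definition scell : Type := ('I_k.+1 + 'I_k)%type.

Definition sfree (d : scell) : bool := if d is inr _ then true else false.

(** With lo and hi, points and intervals are treated alike: the cell is
    [lo/k, 1 - hi/k] and its polynomial x^lo (1 - x)^hi; the reflection x -> 1 - x
    exchanges lo and hi. *)
Definition slo (d : scell) : nat := match d with inl m => m | inr m => m end.
Definition shi (d : scell) : nat :=
  match d with inl m => k - m | inr m => k.-1 - m end.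

Definition bpoly (a b : nat) : {poly R} := 'X^a * (1 - 'X)^+b.

Lemma horner_bpoly a b x : (bpoly a b).[x] = x ^+ a * (1 - x) ^+ b.
Proof. by rewrite hornerM hornerXn horner_exp !hornerE. Qed.

Lemma size_bpoly a b : (size (bpoly a b) <= (a + b).+1)%N.
Proof.
rewrite (leq_trans (size_polyMleq _ _))// size_polyXn addSn /=.
rewrite -addnS leq_add2l (leq_trans (size_poly_exp_leq _ _))// ltnS.
have : (size (1 - 'X : {poly R})%R <= 2)%N.
  by rewrite (leq_trans (size_polyD _ _))// size_polyN size_polyX size_poly1.
by case: size => [|[|[|]]]//= _; rewrite ?mul0n ?mul1n.
Qed.

Definition bern (d : scell) : {poly R} := bpoly (slo d) (shi d).

(** Parametrization of the small cell by [0,1], constant if it is a point. *)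
Definition spos (d : scell) : {poly R} :=
  k%:R^-1 *: ((slo d)%:R%:P + if sfree d then 'X else 0).

(** Between two intervals, k times the integral over [d] of the polynomial of [c];
    between two points, where [spos d] is constant, the value at [d]. *)
Definition pairing (c d : scell) : R :=
  (sfree c == sfree d)%:R * poly_integral (bern c \Po spos d).

Hypothesis k_gt0 : (0 < k)%N.

(** Dividing by (1 - x)^r turns the sum into a polynomial in x / (1 - x). *)
Lemma bernstein_indep r (a : nat -> R) : (k.-1 <= r)%N ->
  (forall l, (l < k)%N ->
     \sum_(m < k) a m * (bpoly m (r - m)).[l%:R / k%:R] = 0) ->
  forall m, (m < k)%N -> a m = 0.
Proof.
move=> kr a0 m mk.
pose y l : R := l%:R / (k - l)%:R.
have kl0 l : (l < k)%N -> (k - l)%:R != 0 :> R.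
  by move=> lk; rewrite pnatr_eq0 subn_eq0 -ltnNge.
have k0 : k%:R != 0 :> R by rewrite pnatr_eq0 -lt0n.
suff p0 : \poly_(m < k) a m = 0.
  by have := congr1 (fun p : {poly R} => p`_m) p0; rewrite coef_poly mk coef0.
apply: (@roots_geq_poly_eq0 _ _ [seq y l | l <- iota 0 k]).
- apply/allP => x /mapP[l]; rewrite mem_iota add0n => /= lk ->{x}.
  rewrite /root horner_poly; have := a0 l lk.
  have -> : \sum_(i < k) a i * (bpoly i (r - i)).[l%:R / k%:R]
            = ((k - l)%:R / k%:R) ^+ r * \sum_(i < k) a i * y l ^+ i.
    rewrite mulr_sumr; apply: eq_bigr => i _; rewrite mulrCA horner_bpoly.
    congr (_ * _).
    have -> : 1 - l%:R / k%:R = (k - l)%:R / k%:R :> R.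
      by rewrite natrB ?(ltnW lk)// mulrBl divff.
    have ir : (i <= r)%N by apply: leq_trans kr; rewrite -ltnS prednK.
    rewrite -[in RHS](subnK ir) exprD -mulrA [RHS]mulrC.
    congr (_ * _); rewrite -exprMn; congr (_ ^+ _).
    by rewrite /y [RHS]mulrC mulrA mulfVK ?kl0.
  by move=> /eqP; rewrite mulf_eq0 expf_eq0 mulf_eq0 invr_eq0 (negPf k0)
     (negPf (kl0 _ lk)) andbF.
- rewrite map_inj_in_uniq ?iota_uniq// => l l'; rewrite !mem_iota /= => lk l'k.
  move=> /eqP; rewrite /y eqr_div ?kl0//.
  rewrite -!natrM eqr_nat !mulnBr [(l' * l)%N]mulnC => /eqP e.
  have le1 : (l * l' <= l * k)%N by rewrite leq_mul2l ltnW// orbT.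
  have le2 : (l * l' <= l' * k)%N by rewrite [leqRHS]mulnC leq_mul2r ltnW// orbT.
  have /eqP : (l * k)%N = (l' * k)%N by rewrite -(subnK le1) e subnK.
  by rewrite eqn_pmul2r// => /eqP.
- by rewrite size_map size_iota size_poly.
Qed.

Lemma unitmx_inj N (M : 'M[R]_N) :
  (forall v : 'rV[R]_N, v *m M = 0 -> v = 0) -> M \in unitmx.
Proof.
move=> inj; rewrite -row_free_unit -kermx_eq0; apply/eqP/row_matrixP => i.
by rewrite row0; apply: inj; rewrite -row_mul mulmx_ker row0.
Qed.

Lemma pairing_point (c : scell) (m : 'I_k.+1) : sfree c = false ->
  pairing c (inl m) = (bern c).[m%:R / k%:R].
Proof.
rewrite /pairing => ->; rewrite eqxx mul1r /spos addr0.
rewrite -mul_polyC -polyCM comp_polyCr /poly_integral.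
have -> : primitive ((bern c).[k%:R^-1 * (slo (inl m))%:R])%:P
          = (bern c).[m%:R / k%:R] *: 'X.
  apply/polyP => -[|[|i]]; rewrite coef_primitive coefZ coefX coefC /=.
  - by rewrite invr0 !mulr0.
  - by rewrite invr1 mulr1 mulr1 mulrC.
  - by rewrite mul0r mulr0.
by rewrite !hornerE subr0.
Qed.

(** The integrals over all the intervals vanish only if the primitive takes the
    same value at k + 1 points, hence is constant by its degree. *)
Lemma interval_unisolvent (Q : {poly R}) : (size Q <= k)%N ->
  (forall m : 'I_k, poly_integral (Q \Po spos (inr m)) = 0) -> Q = 0.
Proof.
move=> sQ Q0; have k0 : k%:R != 0 :> R by rewrite pnatr_eq0 -lt0n.
pose W := primitive Q.
have step m : (m < k)%N -> W.[m.+1%:R / k%:R] = W.[m%:R / k%:R].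
  move=> mk; have := Q0 (Ordinal mk).
  have -> : Q \Po spos (inr (Ordinal mk))
            = (k%:R *: (W \Po spos (inr (Ordinal mk))))^`().
    rewrite derivZ deriv_comp deriv_primitive derivZ derivD derivC derivX add0r.
    by rewrite mulrC -scalerAl mul1r scalerA divff// scale1r.
  rewrite poly_integral_deriv !hornerZ !horner_comp !hornerE /= -mulrBr => /eqP.
  rewrite mulf_eq0 (negPf k0) subr_eq0 /= => /eqP.
  by rewrite -mulrSr [_ * k%:R^-1]mulrC [m%:R / _]mulrC.
have W0 m : (m <= k)%N -> W.[m%:R / k%:R] = W.[0].
  by elim: m => [|m IH] mk; rewrite ?mul0r// step// IH// ltnW.
have : W - W.[0]%:P = 0.
  apply: (@roots_geq_poly_eq0 _ _ [seq l%:R / k%:R | l <- iota 0 k.+1]).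
  - apply/allP => x /mapP[l]; rewrite mem_iota add0n ltnS => /= lk ->{x}.
    by rewrite /root !hornerE W0// subrr.
  - rewrite map_inj_uniq ?iota_uniq// => l l' /(divIf k0)/eqP.
    by rewrite eqr_nat => /eqP.
  - rewrite size_map size_iota (leq_trans (size_polyD _ _))// geq_max size_polyN.
    rewrite (leq_trans (size_polyC_leq1 _))// andbT.
    by rewrite (leq_trans (size_poly _ _)).
move/(congr1 (@deriv _)); rewrite derivB derivC deriv_primitive.
by rewrite subr0 linear0.
Qed.

(** At the point 1 only the last Bernstein polynomial is nonzero, so that its
    coefficient vanishes and k polynomials are left for k points. *)
Lemma point_pairing_unit :
  \matrix_(c < k.+1, d < k.+1) pairing (inl c) (inl d) \in unitmx.
Proof.
have k0 : k%:R != 0 :> R by rewrite pnatr_eq0 -lt0n.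
apply: unitmx_inj => v v0.
have {v0}E (l : 'I_k.+1) :
    \sum_(m < k.+1) v 0 m * (bpoly m (k - m)).[l%:R / k%:R] = 0.
  have := congr1 (fun A : 'rV_k.+1 => A 0 l) v0; rewrite !mxE => vl.
  rewrite -[RHS]vl; apply: eq_bigr => m _; by rewrite mxE pairing_point.
have vk : v 0 ord_max = 0.
  rewrite -[RHS](E ord_max) big_ord_recr /= divff// big1 ?add0r.
    by rewrite horner_bpoly subnn expr1n !mulr1.
  move=> m _; rewrite horner_bpoly subrr expr0n subn_eq0 leqNgt ltn_ord.
  by rewrite !mulr0.
apply/rowP => m; rewrite [RHS]mxE.
case: (unliftP ord_max m) => [m' ->|-> //].
have -> : lift ord_max m' = inord m' :> 'I_k.+1.
  by apply/val_inj => /=; rewrite inordK ?ltnS 1?ltnW ?ltn_ord// /bump leqNgt ltn_ord.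
apply: (@bernstein_indep k (fun m => v 0 (inord m))) => //.
  exact: leq_pred.
move=> l lk; have := E (inord l).
rewrite big_ord_recr /= vk mul0r addr0 inordK ?ltnS 1?ltnW// => El.
rewrite -[RHS]El; apply: eq_bigr => i _; congr (v 0 _ * _).
by apply/val_inj; rewrite /= inordK// ltnS ltnW.
Qed.

Lemma interval_pairing_unit :
  \matrix_(c < k, d < k) pairing (inr c) (inr d) \in unitmx.
Proof.
apply: unitmx_inj => v v0; pose Q := \sum_(m < k) v 0 m *: bern (inr m).
have Q0 : Q = 0.
  apply: interval_unisolvent => [|d].
    apply: (leq_trans (size_sum _ _ _)); apply/bigmax_leqP => m _.
    rewrite (leq_trans (size_scale_leq _ _))// (leq_trans (size_bpoly _ _))//=.
    by rewrite subnKC ?prednK// -ltnS prednK.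
  have := congr1 (fun A : 'rV_k => A 0 d) v0; rewrite !mxE => vd; rewrite -[RHS]vd.
  rewrite /Q raddf_sum raddf_sum; apply: eq_bigr => m _.
  by rewrite /= comp_polyZ linearZ /= mxE /pairing eqxx mul1r.
apply/rowP => m; rewrite [RHS]mxE.
pose a i := if insub i is Some j then v 0 (j : 'I_k) else 0.
have aE (j : 'I_k) : a j = v 0 j by rewrite /a valK.
rewrite -aE; apply: (@bernstein_indep k.-1 a) => // l _.
have := congr1 (fun P : {poly R} => P.[l%:R / k%:R]) Q0.
rewrite horner0 horner_sum => El; rewrite -[RHS]El.
by apply: eq_bigr => i _; rewrite hornerZ aE.
Qed.

Lemma pairing_dual : exists L : scell -> scell -> R,
  forall c e, \sum_d pairing c d * L d e = (c == e)%:R.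
Proof.
pose A := \matrix_(c < k.+1, d < k.+1) pairing (inl c) (inl d).
pose B := \matrix_(c < k, d < k) pairing (inr c) (inr d).
exists (fun d e => match d, e with
  | inl d, inl e => invmx A d e | inr d, inr e => invmx B d e | _, _ => 0 end).
have cross c d : sfree c != sfree d -> pairing c d = 0.
  by rewrite /pairing => /negPf ->; rewrite mul0r.
move=> [c|c] [e|e]; rewrite big_sumType /=.
- rewrite [X in _ + X]big1 ?addr0 => [|d _]; last by rewrite mulr0.
  have := congr1 (fun M : 'M[R]_k.+1 => M c e) (mulmxV point_pairing_unit).
  rewrite /= !mxE => <-; apply: eq_bigr => d _; rewrite mxE //.
- rewrite !big1 ?addr0// => d _; first by rewrite cross ?mul0r.
  by rewrite mulr0.
- rewrite !big1 ?addr0// => d _; first by rewrite mulr0.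
  by rewrite cross ?mul0r.
- rewrite [X in X + _]big1 ?add0r => [|d _]; last by rewrite mulr0.
  have := congr1 (fun M : 'M[R]_k => M c e) (mulmxV interval_pairing_unit).
  rewrite /= !mxE => <-; apply: eq_bigr => d _; rewrite mxE //.
Qed.

Lemma pairing_diag_gt0 d : 0 < pairing d d.
Proof.
have k0 : 0 < k%:R :> R by rewrite ltr0n.
case: d => m.
  rewrite pairing_point// horner_bpoly /=.
  have [->|m0] := eqVneq (m : nat) 0%N.
    by rewrite mul0r subr0 expr1n mulr1 expr0.
  apply: mulr_gt0; first by rewrite exprn_gt0// divr_gt0// ltr0n lt0n.
  have [->|mk] := eqVneq (m : nat) k; first by rewrite subnn expr0.
  rewrite exprn_gt0 // subr_gt0 ltr_pdivrMr// mul1r ltr_nat.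
  by rewrite ltn_neqAle mk leq_ord.
rewrite /pairing eqxx mul1r; apply: poly_integral_gt0 => t /andP[t0 t1].
rewrite horner_comp horner_bpoly !hornerE /=.
have mk : m%:R + 1 <= k%:R :> R by rewrite natr1 ler_nat.
have p : 0 < k%:R^-1 * (m%:R + t) :> R.
  by rewrite mulr_gt0 ?invr_gt0// ltr_wpDl.
have q : 0 < 1 - k%:R^-1 * (m%:R + t) :> R.
  rewrite subr_gt0 mulrC ltr_pdivrMr// mul1r (lt_le_trans _ mk)//.
  by rewrite ltrD2l.
by rewrite mulr_gt0// exprn_gt0.
Qed.

End SmallCells.

(** * Affine bijections between faces of cubes *)

Section Flip.
Variable R : realType.

Lemma flipK e : involutive (@flip R e).
Proof. by case: e => t //=; rewrite /flip; ring. Qed.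

Lemma flip_natr e (y : bool) : flip e y%:R = (e (+) y)%:R :> R.
Proof. by case: e; case: y; rewrite /flip ?subrr ?subr0. Qed.

End Flip.

(** A bijection between the free coordinates; the values of [g] at the other
    coordinates are arbitrary. *)
Definition face_matching n m (tau : cface n) (tau' : cface m)
    (g : 'I_m -> 'I_n) : Prop :=
  [/\ forall l, tau' l = None -> tau (g l) = None,
      forall l l', tau' l = None -> tau' l' = None -> g l = g l' -> l = l' &
      forall i, tau i = None -> exists2 l, tau' l = None & g l = i].

Section FacePoint.
Variables (R : realType) (n : nat).
Implicit Types (tau : cface n) (t : 'I_n -> R).

Definition face_point tau t : 'rV[R]_n :=
  \row_j if tau j is Some y then y%:R else t j.

Lemma face_point_in tau t :
  (forall j, tau j = None -> 0 <= t j <= 1) -> face_set R tau (face_point tau t).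
Proof. by move=> t01 j; rewrite mxE; case E: (tau j) => [y|] //; exact: t01. Qed.

Lemma face_setP tau x y : face_set R tau x -> face_set R tau y ->
  (forall j, tau j = None -> x 0 j = y 0 j) -> x = y.
Proof.
move=> tx ty xy; apply/rowP => j; have := tx j; have := ty j; have := xy j.
by case: (tau j) => [b _ -> ->|->].
Qed.

Lemma face_set_itv tau x : face_set R tau x -> forall j, 0 <= x 0 j <= 1.
Proof.
by move=> tx j; have := tx j; case: (tau j) => [[] ->|//]; rewrite lexx ler01.
Qed.

End FacePoint.

Section FaceBijection.
Variables (R : realType) (n m : nat) (tau : cface n) (tau' : cface m).
Variables (c : 'rV[R]_m) (M : 'M[R]_(n, m)).
Let T x := c + x *m M.
Let X := face_set R tau.
Let Y := face_set R tau'.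
Hypothesis T_face : forall x, X x -> Y (T x).
Hypothesis T_onto : forall y, Y y -> exists2 x, X x & T x = y.
Hypothesis T_inj : forall x x', X x -> X x' -> T x = T x' -> x = x'.

(** Vertices are the points which are not midpoints of a segment of the face,
    and an affine bijection preserves midpoints. *)
Lemma vertex_to_vertex (t : 'I_n -> bool) j : tau' j = None ->
  exists y : bool, T (face_point tau (fun i => (t i)%:R)) 0 j = y%:R.
Proof.
move=> j_free; set x := face_point _ _.
have Xx : X x by apply: face_point_in => i _; case: (t i); rewrite ?lexx ler01.
have x01 i : x 0 i = 0 \/ x 0 i = 1.
  by rewrite mxE; case: (tau i) => [[]|]; last case: (t i); auto.
clearbody x; have Yy : Y (T x) := T_face Xx.
have [y yE] : exists y, y = T x by exists (T x).
rewrite -yE in Yy *.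
have [y0|y0] := eqVneq (y 0 j) 0; first by exists false.
have [y1|y1] := eqVneq (y 0 j) 1; first by exists true.
have /andP[] := face_set_itv Yy j.
rewrite [_ <= y 0 j]le_eqVlt eq_sym (negPf y0) /= => y_gt0.
rewrite [_ <= 1]le_eqVlt (negPf y1) /= => y_lt1.
pose eps := Num.min (y 0 j) (1 - y 0 j).
have eps_gt0 : 0 < eps by rewrite lt_min y_gt0 subr_gt0.
have eps_y : eps <= y 0 j by rewrite ge_min lexx.
have eps_y' : eps <= 1 - y 0 j by rewrite ge_min lexx orbT.
have Yeps s : `|s| <= eps -> Y (y + s *: delta_mx 0 j).
  move=> s_eps i; have := Yy i; rewrite !mxE eqxx /=.
  have [->|_] := eqVneq i j; last by rewrite mulr0 addr0.
  rewrite j_free mulr1 => _; move: s_eps; rewrite ler_norml => /andP[s1 s2].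
  by apply/andP; split; lra.
have [|x1 Xx1 Tx1] := T_onto (Yeps eps _); first by rewrite gtr0_norm.
have [|x2 Xx2 Tx2] := T_onto (Yeps (- eps) _); first by rewrite normrN gtr0_norm.
have mid : 2^-1 *: (x1 + x2) = x.
  apply: T_inj => //; last rewrite -yE.
    move=> i; have := Xx1 i; have := Xx2 i; rewrite !mxE.
    case: (tau i) => [b -> ->|]; first by field.
    by move=> /andP[p1 p2] /andP[p3 p4]; apply/andP; split; lra.
  apply/rowP => i; rewrite /T -scalemxAl mulmxDl.
  have := congr1 (fun A : 'rV[R]_m => A 0 i) Tx1.
  have := congr1 (fun A : 'rV[R]_m => A 0 i) Tx2.
  rewrite yE /T !mxE => e2 e1. lra.
have x12 : x1 = x2.
  apply/rowP => i; have := congr1 (fun A : 'rV[R]_n => A 0 i) mid.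
  have /andP[p1 p2] := face_set_itv Xx1 i; have /andP[p3 p4] := face_set_itv Xx2 i.
  by rewrite !mxE; have := x01 i => -[] ->; lra.
have := congr1 (fun A : 'rV[R]_m => A 0 j) Tx1.
have := congr1 (fun A : 'rV[R]_m => A 0 j) Tx2.
rewrite x12 !mxE !eqxx /= => -> e.
suff : eps <= 0 by rewrite leNgt eps_gt0.
lra.
Qed.

(** At the vertices the coordinate [l] of the image only takes the values 0 and 1.
    Two nonzero slopes would produce a third value, and no nonzero slope would
    make it constant. *)
Lemma face_bijection_coord l : tau' l = None ->
  exists i e, tau i = None /\ forall x, X x -> T x 0 l = flip e (x 0 i).
Proof.
move=> l_free.
pose v t := face_point tau (fun i => (t i : bool)%:R : R).
pose v0 := v (fun _ => false).
have TE x : X x -> T x 0 l = T v0 0 l + \sum_(i | tau i == None) x 0 i * M i l.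
  move=> Xx; rewrite !mxE -addrA; congr (_ + _).
  rewrite (bigID (fun i => tau i == None)) [in RHS](bigID (fun i => tau i == None)).
  rewrite /= [X in _ = X + _ + _]big1 ?add0r.
    rewrite addrC; congr (_ + _); apply: eq_bigr => i; rewrite mxE.
    by have := Xx i; case: (tau i) => // y ->.
  by move=> i /eqP iN; rewrite mxE iN mul0r.
have Xv t : X (v t) by apply: face_point_in => i _; case: (t i); rewrite ?lexx ler01.
have [s0 s0E] := vertex_to_vertex (fun _ => false) l_free.
have vE t i : tau i = None -> v t 0 i = (t i)%:R by rewrite mxE => ->.
have T1 i : tau i = None -> exists y : bool, s0%:R + M i l = y%:R.
  move=> iN; have [y yE] := vertex_to_vertex (fun j => j == i) l_free.
  exists y; rewrite -yE (TE _ (Xv (fun j => j == i))) s0E; congr (_ + _).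
  rewrite (bigD1 i) ?iN//= vE// eqxx mul1r big1 ?addr0// => j /andP[/eqP jN ji].
  by rewrite vE// (negPf ji) mul0r.
have T2 i i' : tau i = None -> tau i' = None -> i' != i ->
    exists y : bool, s0%:R + (M i l + M i' l) = y%:R.
  move=> iN i'N i'i.
  have [y yE] := vertex_to_vertex (fun j => (j == i) || (j == i')) l_free.
  exists y; rewrite -yE (TE _ (Xv (fun j => (j == i) || (j == i')))) s0E; congr (_ + _).
  rewrite (bigD1 i) ?iN//= vE// eqxx mul1r; congr (_ + _).
  rewrite (bigD1 i') ?i'N//= vE// eqxx orbT mul1r big1 ?addr0//.
  move=> j /andP[/andP[/eqP jN ji] ji'].
  by rewrite vE// (negPf ji) (negPf ji') mul0r.
(* the image point obtained from [T v0] by changing only the coordinate [l] *)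
have [i iN Mi] : exists2 i, tau i = None & M i l != 0.
  pose y : 'rV[R]_m := \row_j if j == l then 1 - s0%:R else T v0 0 j.
  have Yy : Y y.
    move=> j; rewrite mxE; have := T_face (Xv (fun _ => false)) j.
    by case: eqVneq => [-> _|//]; rewrite l_free; case: (s0);
      rewrite ?subrr ?subr0 ?lexx ler01.
  have [x Xx Tx] := T_onto Yy.
  apply: contrapT => no.
  have := TE x Xx; rewrite s0E Tx mxE eqxx big1 => [|i /eqP iN].
    by case: (s0) => /=; lra.
  have [->|Mi] := eqVneq (M i l) 0; first by rewrite mulr0.
  by exfalso; apply: no; exists i.
have M0 i' : tau i' = None -> i' != i -> M i' l = 0.
  move=> i'N i'i; have [y] := T2 _ _ iN i'N i'i.
  have [z] := T1 _ i'N; have [z'] := T1 _ iN.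
  by move: Mi => /eqP; case: (s0) (y) (z) (z') => [] [] [] [] /=; lra.
exists i, s0; split=> // x Xx; rewrite TE// s0E (bigD1 i) ?iN//= big1.
  have [y] := T1 _ iN; rewrite addr0 /flip.
  move: Mi => /eqP; case: (s0) (y) => [] [] /= Mi /eqP ME.
  - by exfalso; apply: Mi; move/eqP: ME; lra.
  - have -> : M i l = -1 by move/eqP: ME; lra.
    by rewrite mulrN1.
  - have -> : M i l = 1 by move/eqP: ME; lra.
    by rewrite mulr1 add0r.
  - by exfalso; apply: Mi; move/eqP: ME; lra.
by move=> i' /andP[/eqP i'N i'i]; rewrite M0// mulr0.
Qed.

(** By surjectivity two coordinates of the image depend on different coordinates
    of the source; by injectivity each free coordinate of the source is used. *)
Lemma face_bijectionP : (m <= n)%N -> exists g e, face_matching tau tau' g /\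
  forall x, X x -> forall l, tau' l = None -> T x 0 l = flip (e l) (x 0 (g l)).
Proof.
move=> le_mn.
have /choice[f fP] (l : 'I_m) : exists ie : 'I_n * bool, tau' l = None ->
    tau ie.1 = None /\ forall x, X x -> T x 0 l = flip ie.2 (x 0 ie.1).
  case E: (tau' l) => [y|]; first by exists (widen_ord le_mn l, false).
  by have [i [e ?]] := face_bijection_coord E; exists (i, e).
exists (fun l => (f l).1), (fun l => (f l).2); split; last first.
  by move=> x Xx l /fP[_]; exact.
split=> [l /fP[] //|l l' lN l'N eg|i iN].
  apply/eqP/negPn/negP => ll'.
  have face01 (P : pred 'I_m) :
      Y (face_point tau' (fun j => (P j)%:R : R)).
    by apply: face_point_in => j _; case: (P j); rewrite ?lexx ler01.
  have [x1 Xx1 Tx1] := T_onto (face01 pred0).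
  have [x2 Xx2 Tx2] := T_onto (face01 (pred1 l')).
  have [_ fl] := fP l lN; have [_ fl'] := fP l' l'N.
  have x12 : x1 0 (f l).1 = x2 0 (f l).1.
    apply: (can_inj (@flipK R (f l).2)); rewrite -!fl// Tx1 Tx2 !mxE lN /=.
    by rewrite (negPf ll').
  have := fl' _ Xx1; rewrite -eg x12 eg -fl'// Tx1 Tx2 !mxE l'N /= eqxx.
  by move=> /eqP; rewrite eq_sym oner_eq0.
apply: contrapT => no.
have face01 (P : pred 'I_n) : X (face_point tau (fun j => (P j)%:R : R)).
  by apply: face_point_in => j _; case: (P j); rewrite ?lexx ler01.
have /rowP/(_ i) : face_point tau (fun=> 0) = face_point tau (fun j => (j == i)%:R) :> 'rV[R]_n.
  apply: (T_inj (face01 pred0) (face01 (pred1 i))).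
  apply: (face_setP (T_face (face01 pred0)) (T_face (face01 (pred1 i)))) => l lN.
  have [gN fl] := fP l lN; rewrite !fl//; congr flip; rewrite !mxE gN /=.
  by have [gl|//] := eqVneq (f l).1 i; exfalso; apply: no; exists l.
by rewrite !mxE iN eqxx => /eqP; rewrite eq_sym oner_eq0.
Qed.

End FaceBijection.

(** The transition map between the faces is affine, because [pinvmx B] recovers [y]
    from [y *m B], so the analysis of affine bijections applies to it. *)
Lemma face_transition (R : realType) n m N (tau : cface n) (tau' : cface m)
    (a b : 'rV[R]_N) (A : 'M[R]_(n, N)) (B : 'M[R]_(m, N)) :
  row_free A -> row_free B -> (m <= n)%N ->
  (fun x => a + x *m A) @` face_set R tau
    = (fun y => b + y *m B) @` face_set R tau' ->
  exists g e, face_matching tau tau' g /\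
    forall x y, face_set R tau x -> face_set R tau' y ->
      a + x *m A = b + y *m B ->
      forall l, tau' l = None -> y 0 l = flip (e l) (x 0 (g l)).
Proof.
move=> freeA freeB le_mn imE.
pose c := (a - b) *m pinvmx B; pose M := A *m pinvmx B.
have T_eq x y : a + x *m A = b + y *m B -> c + x *m M = y.
  move=> xy; rewrite /c /M mulmxA -mulmxDl addrAC xy [b + _]addrC addrK.
  by rewrite -mulmxA mulmxVp// mulmx1.
have into x : face_set R tau x ->
    exists2 y, face_set R tau' y & a + x *m A = b + y *m B.
  move=> tx; have : ((fun x => a + x *m A) @` face_set R tau) (a + x *m A).
    by exists x.
  by rewrite imE => -[y ty xy]; exists y.
have [x tx|y ty|x x' tx tx'|//|g [e [gm ge]]] :=
  @face_bijectionP R n m tau tau' c M.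
- by have [y ty /T_eq ->] := into x tx.
- have : ((fun y => b + y *m B) @` face_set R tau') (b + y *m B) by exists y.
  by rewrite -imE => -[x tx /T_eq xy]; exists x.
- have [y _ xy] := into x tx; have [y' _ xy'] := into x' tx'.
  rewrite (T_eq _ _ xy) (T_eq _ _ xy') => yy'; move: xy; rewrite yy' -xy'.
  by move=> /addrI/(row_free_inj freeA).
exists g, e; split=> // x y tx ty /T_eq <- l; exact: ge.
Qed.

(** * Small cubes as boxes of small cells *)

Section Boxes.
Variables (R : realType) (n k : nat).
Hypothesis k_gt0 : (0 < k)%N.

Definition box := {ffun 'I_n -> scell k}.

Definition scell_of (m : 'I_k) (y : option bool) : scell k :=
  if y is Some y then inl (inord (m + y)) else inr m.

(** The box removes the redundancy of the indices: a point m/k with 0 < m < k is an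
    end of both adjacent intervals and therefore has two indices. *)
Definition box_of p (c : small_index n k p) : box :=
  [ffun l => scell_of (c.1 l) (val c.2 l)].

Definition box_free (B : box) : {set 'I_n} := [set l | sfree (B l)]%SET.

Lemma slo_scell_of m y : slo (scell_of m y) = (m + (y == Some true))%N.
Proof.
case: y => [[]|] /=; rewrite ?addn0// inordK ?addn0//.
- by rewrite addn1 ltnS.
- exact: ltnW (ltn_ord m).
Qed.

Lemma shi_scell_of m y :
  shi (scell_of m y) = (k.-1 - m + (y == Some false))%N.
Proof.
have mk := ltn_ord m; case: y => [[]|] /=; rewrite ?addn0// inordK ?addn0//.
- by rewrite addn1 -[X in (X - _)%N](prednK k_gt0) subSS.
- by rewrite addn1 ltnS.
- by rewrite addn1 -subSn ?prednK// -ltnS prednK.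
- exact: ltnW.
Qed.

Lemma sfree_scell_of m y : sfree (scell_of m y) = (y == None).
Proof. by case: y. Qed.

Lemma box_free_of p (c : small_index n k p) :
  box_free (box_of c) = free_coords (val c.2).
Proof. by apply/setP => l; rewrite !inE ffunE sfree_scell_of. Qed.

Lemma card_box_free p (c : small_index n k p) : #|box_free (box_of c)| = p.
Proof. by rewrite box_free_of; apply/eqP; exact: (valP c.2). Qed.

Lemma box_ofP p (B : box) : #|box_free B| = p ->
  exists c : small_index n k p, box_of c = B.
Proof.
move=> Bp.
pose kk : {ffun 'I_n -> 'I_k} :=
  [ffun l => match B l with
             | inl m => if (m < k)%N then insubd (Ordinal k_gt0) (m : nat)
                        else insubd (Ordinal k_gt0) k.-1
             | inr m => m end].
pose tau : cface n := [ffun l => match B l with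
             | inl m => Some (m == k :> nat) | inr m => None end].
have tauB : free_coords tau = box_free B.
  by apply/setP => l; rewrite !inE ffunE; case: (B l).
have tau_p : #|free_coords tau| == p by rewrite tauB Bp.
exists (kk, Sub tau tau_p); apply/ffunP => l; rewrite ffunE SubK /= !ffunE.
case: (B l) => // m /=; congr inl; apply/val_inj => /=.
have := ltn_ord m; rewrite ltnS leq_eqVlt => /orP[/eqP ->|mk].
  have kk1 : insubd (Ordinal k_gt0) k.-1 = k.-1 :> nat.
    by rewrite val_insubd ltn_predL k_gt0.
  by rewrite ltnn kk1 eqxx addn1 prednK// inordK.
have mm : insubd (Ordinal k_gt0) (m : nat) = m :> nat by rewrite val_insubd mk.
by rewrite mk mm (ltn_eqF mk) addn0 inordK.
Qed.

Lemma eq_free_coord p (tau tau' : pface n p) :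
  free_coords (val tau) = free_coords (val tau') -> free_coord tau = free_coord tau'.
Proof.
move=> E; apply/funext => b; rewrite /free_coord.
rewrite (enum_val_nth (free_coord tau b)) [RHS](enum_val_nth (free_coord tau b)).
by rewrite /= E.
Qed.

Lemma free_coord_inj p (tau : pface n p) : injective (free_coord tau).
Proof. by move=> b b' /enum_val_inj/cast_ord_inj. Qed.

Lemma free_coord_free p (tau : pface n p) b : val tau (free_coord tau b) = None.
Proof.
apply/eqP; have := enum_valP (cast_ord (esym (eqP (valP tau))) b).
by rewrite inE.
Qed.

Lemma free_coord_onto p (tau : pface n p) l : val tau l = None ->
  exists b, free_coord tau b = l.
Proof.
move=> lN; have lF : l \in free_coords (val tau) by rewrite inE lN.
exists (cast_ord (eqP (valP tau)) (enum_rank_in lF l)).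
by rewrite /free_coord cast_ordK enum_rankK_in.
Qed.

Lemma cube_formE p (c : small_index n k p) (x : 'rV[R]_n) v :
  cube_form R c x v
  = (\prod_l (bern R (box_of c l)).[x 0 l]) * \det (colsub (free_coord c.2) v).
Proof.
rewrite /cube_form /whitney_form mulrA -big_split /=; congr (_ * _).
apply: eq_bigr => l _; rewrite ffunE horner_bpoly slo_scell_of shi_scell_of.
rewrite !exprD mulrACA; congr (_ * _).
by case: (val c.2 l) => [[]|] /=; rewrite ?expr0 ?mulr1 ?mul1r.
Qed.

Lemma eq_cube_form p (c d : small_index n k p) :
  box_of c = box_of d -> cube_form R c = cube_form R d.
Proof.
move=> cd; apply/funext => x; apply/funext => v; rewrite !cube_formE cd.
by rewrite (@eq_free_coord _ c.2 d.2)// -!box_free_of cd.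
Qed.

Definition in_scell (d : scell k) (z : R) : bool :=
  (slo d)%:R / k%:R <= z <= 1 - (shi d)%:R / k%:R.

Let k0 : k%:R != 0 :> R. Proof. by rewrite pnatr_eq0 -lt0n. Qed.
Let k_pos : 0 < k%:R :> R. Proof. by rewrite ltr0n. Qed.

Lemma shi_eq (d : scell k) :
  1 - (shi d)%:R / k%:R = ((slo d)%:R + (sfree d)%:R) / k%:R :> R.
Proof.
apply: (mulIf k0); rewrite mulrBl mul1r !mulfVK//.
case: d => m /=.
  by rewrite natrB ?leq_ord//; ring.
by rewrite -subn1 -subnDA natrB ?natrD ?add1n ?ltn_ord//; ring.
Qed.

Lemma in_scellP d z : in_scell d z <->
  exists2 x, 0 <= x <= 1 & z = (spos R d).[x].
Proof.
rewrite /in_scell shi_eq /spos; split.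
  move=> /andP[z1 z2]; exists (z * k%:R - (slo d)%:R).
    move: z1 z2; rewrite ler_pdivrMr// ler_pdivlMr// => z1 z2.
    rewrite subr_ge0 z1 /= lerBlDr (le_trans z2)//.
    by rewrite addrC lerD2r; case: (sfree d).
  case E: (sfree d) z1 z2 => /= z1 z2; rewrite hornerZ hornerD hornerC.
    by rewrite hornerX addrC subrK mulrC mulfK.
  rewrite addr0 in z2; rewrite horner0 addr0 mulrC.
  by apply: le_anti; rewrite z1 z2.
move=> [x /andP[x0 x1] ->]; rewrite hornerZ hornerD hornerC.
rewrite [k%:R^-1 * _]mulrC ler_pM2r ?invr_gt0// ler_pM2r ?invr_gt0// lerD2l lerDl.
by case: (sfree d); rewrite /= ?hornerX ?horner0 ?x0 ?x1 ?lexx.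
Qed.

Lemma spos_const (d : scell k) : sfree d = false -> forall x, (spos R d).[x] = (spos R d).[0].
Proof. by rewrite /spos => -> x; rewrite !hornerE. Qed.

Lemma small_mapE p (c : small_index n k p) (x : 'rV[R]_n) :
  face_set R (val c.2) x ->
  forall l, small_map c.1 x 0 l = (spos R (box_of c l)).[x 0 l].
Proof.
move=> cx l; rewrite mxE /spos ffunE slo_scell_of sfree_scell_of.
rewrite hornerZ hornerD hornerC natrD -addrA; congr (_ * (_ + _)).
have := cx l; case: (val c.2 l) => [[] ->|_] /=.
- by rewrite horner0 addr0.
- by rewrite horner0 addr0.
- by rewrite hornerX add0r.
Qed.

Lemma small_cubeP p (c : small_index n k p) z :
  small_cube R c z <-> forall l, in_scell (box_of c l) (z 0 l).
Proof.
split=> [[x cx <-] l|cz].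
  by apply/in_scellP; exists (x 0 l); [exact: face_set_itv cx l|exact: small_mapE].
have /choice[t tP] l : exists x, 0 <= x <= 1 /\ z 0 l = (spos R (box_of c l)).[x].
  by have /in_scellP[x ? ?] := cz l; exists x.
have cx : face_set R (val c.2) (face_point (val c.2) t).
  by apply: face_point_in => l _; have [] := tP l.
exists (face_point (val c.2) t) => //.
apply/rowP => l; rewrite small_mapE// mxE; have [_ ->] := tP l.
case E: (val c.2 l) => [y|//]; rewrite spos_const ?[RHS]spos_const//.
  by rewrite ffunE sfree_scell_of E.
by rewrite ffunE sfree_scell_of E.
Qed.

Lemma pairing_nonfree (c d : scell k) : sfree c = false -> sfree d = false ->
  pairing R c d = (bern R c).[(spos R d).[0]].
Proof.
case: d => // m cN _; rewrite pairing_point//; congr (horner _ _).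
by rewrite !hornerE /= mulrC.
Qed.

Lemma pairing_cross (c d : scell k) : sfree c != sfree d -> pairing R c d = 0.
Proof. by rewrite /pairing => /negPf ->; rewrite mul0r. Qed.

Lemma det_zero_col q (M : 'M[R]_q) j : (forall i, M i j = 0) -> \det M = 0.
Proof. by move=> Mj; rewrite (expand_det_col M j) big1// => i _; rewrite Mj mul0r. Qed.

(** * Integrals of cubical forms over oriented small cubes *)

Definition full_face p : cface p := [ffun=> None].

Lemma unit_cubeE p : unit_cube R p = face_set R (full_face p).
Proof.
by apply/seteqP; split=> t t01 j; have := t01 j; rewrite /= ?ffunE.
Qed.

Lemma oriented_cellE N p (u : set 'rV[R]_N) (o : oriented_cell p u) :
  u = (fun t => obase o + t *m oframe o) @` face_set R (full_face p).
Proof. by case: o => ob F s uE; rewrite -unit_cubeE. Qed.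

Section OrientedSmallCube.
Variables (A : 'M[R]_n) (b : 'rV[R]_n) (p : nat) (c0 : small_index n k p).
Hypothesis A_unit : A \in unitmx.
Variables (u : set 'rV[R]_n) (o : oriented_cell p u).
Hypothesis uE : u = affine_map A b @` small_cube R c0.

Let F := oframe o.
Let tau0 := val c0.2.
Let A' := k%:R^-1 *: A.
Let b' := b + (k%:R^-1 *: \row_l (c0.1 l)%:R) *m A.

Lemma affine_small_map x : affine_map A b (small_map c0.1 x) = b' + x *m A'.
Proof.
rewrite /affine_map addrC /b' -addrA /A' -scalemxAr scalemxAl -mulmxDl.
congr (b + _ *m A); apply/rowP => l; rewrite !mxE mulrDr //.
Qed.

Lemma small_image : u = (fun x => b' + x *m A') @` face_set R tau0.
Proof.
rewrite uE /small_cube image_comp; apply: eq_imagel => x _ /=.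
exact: affine_small_map.
Qed.

Lemma param_image :
  (fun t => obase o + t *m F) @` face_set R (full_face p)
  = (fun x => b' + x *m A') @` face_set R tau0.
Proof. by rewrite -small_image; exact: esym (oriented_cellE o). Qed.

Lemma scaled_unit : A' \in unitmx.
Proof. by rewrite unitmxZ// unitfE invr_eq0. Qed.

(** The rows of the frame span the p free directions of the small cube. *)
Lemma oframe_free : row_free F.
Proof.
pose V := rowsub (free_coord c0.2) A'.
have V_free : row_free V.
  apply/row_freeP; exists (invmx A' *m colsub (free_coord c0.2) 1%:M).
  rewrite mulmxA mul_rowsub_mx mulmxV ?scaled_unit// mulmx_colsub mulmx1.
  apply/matrixP => i j; rewrite !mxE.
  by rewrite (inj_eq (@free_coord_inj _ c0.2)).
have VF : (V <= F)%MS.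
  apply/row_subP => i; pose l := free_coord c0.2 i.
  have lN : tau0 l = None by exact: free_coord_free.
  have pt (s : bool) : exists t, b' + face_point tau0 (fun j => (s && (j == l))%:R) *m A'
      = obase o + t *m F.
    have : ((fun x => b' + x *m A') @` face_set R tau0)
        (b' + face_point tau0 (fun j => (s && (j == l))%:R) *m A').
      eexists; last by [].
      by apply: face_point_in => j _; case: (s && (j == l)); rewrite ?lexx ler01.
    by rewrite -param_image => -[t _ tE]; exists t.
  have [t0 e0] := pt false; have [t1 e1] := pt true.
  apply/submxP; exists (t1 - t0).
  have : (b' + face_point tau0 (fun j => (true && (j == l))%:R) *m A')
       - (b' + face_point tau0 (fun j => (false && (j == l))%:R) *m A')
       = (t1 - t0) *m F.
    by rewrite e0 e1 mulmxBl opprD addrACA subrr add0r.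
  move=> <-; rewrite opprD addrACA subrr add0r -mulmxBl.
  transitivity ((delta_mx 0 l : 'rV[R]_n) *m A'); first by rewrite -rowE /V row_rowsub.
  congr (_ *m A'); apply/rowP => j; rewrite !mxE eqxx /=.
  have [->|jl] := eqVneq j l; first by rewrite lN subr0.
  by case: (tau0 j) => [y|]; rewrite subrr.
rewrite /row_free eqn_leq rank_leq_row /=.
have /eqP rV := V_free; by rewrite -[X in (X <= _)%N]rV; exact: mxrankS.
Qed.

Definition local_coord (t : 'rV[R]_p) : 'rV[R]_n :=
  (obase o + t *m F - b) *m invmx A.

Lemma leq_dim : (p <= n)%N.
Proof.
rewrite -(eqP (valP c0.2)); apply: (leq_trans (max_card _)).
by rewrite card_ord.
Qed.

(** In the local coordinates an oriented small cube is parametrized by a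
    permutation of its p parameters, with reflections. *)
Lemma local_param : exists g e, face_matching tau0 (full_face p) g /\
  forall t, unit_cube R p t ->
    (forall i, local_coord t 0 (g i)
       = (spos R (box_of c0 (g i))).[flip (e i) (t 0 i)]) /\
    (forall l, tau0 l != None -> local_coord t 0 l = (spos R (box_of c0 l)).[0]).
Proof.
have A'_free : row_free A' by rewrite row_free_unit scaled_unit.
have [g [e [gm ge]]] := face_transition A'_free oframe_free leq_dim (esym param_image).
exists g, e; split=> // t t01.
have ut : face_set R (full_face p) t by rewrite -unit_cubeE.
have : ((fun t => obase o + t *m oframe o) @` face_set R (full_face p))
         (obase o + t *m oframe o) by exists t.
rewrite param_image => -[x tx xt].
have -> : local_coord t = small_map c0.1 x.
  rewrite /local_coord /F -xt -affine_small_map /affine_map addrK mulmxK //.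
split=> [i|l lN]; rewrite small_mapE//.
  by rewrite (ge x t)// ?ffunE// flipK.
by rewrite spos_const// ffunE sfree_scell_of (negPf lN).
Qed.

Lemma frame_col (l : 'I_n) i :
  (F *m invmx A) i l = local_coord (delta_mx 0 i) 0 l - local_coord 0 0 l.
Proof.
have -> : local_coord (delta_mx 0 i) 0 l - local_coord 0 0 l
        = (local_coord (delta_mx 0 i) - local_coord 0) 0 l by rewrite !mxE.
rewrite -mulmxBl mul0mx addr0 opprB addrA subrK [obase o + _]addrC addrK.
by rewrite -rowE -row_mul [RHS]mxE.
Qed.

Lemma delta_in_cube (i : 'I_p) : unit_cube R p (delta_mx 0 i).
Proof. by move=> j; rewrite mxE eqxx /=; case: eqP; rewrite ?lexx ler01. Qed.

Lemma zero_in_cube q : unit_cube R q 0.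
Proof. by move=> j; rewrite mxE lexx ler01. Qed.

Lemma frame_col_nonfree l i : tau0 l != None -> (F *m invmx A) i l = 0.
Proof.
move=> lN; have [g [e [_ loc]]] := local_param; rewrite frame_col.
have [_ ->//] := loc _ (delta_in_cube i); have [_ ->//] := loc _ (@zero_in_cube p).
by rewrite subrr.
Qed.

(** The part of the integral over the oriented cell that does not depend on the
    form being integrated. *)
Definition cell_scale : R :=
  (-1) ^+ osign o * \det (colsub (free_coord c0.2) (F *m invmx A)).

Lemma cell_scale_neq0 : cell_scale != 0.
Proof.
rewrite mulf_neq0 ?signr_eq0// -unitfE -[_ \is a _]unitmxE -row_free_unit.
pose f := free_coord c0.2.
have E (G : 'M[R]_(p, n)) : (forall i l, tau0 l != None -> G i l = 0) ->
    G = colsub f G *m rowsub f 1%:M.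
  move=> G0; apply/matrixP => i l; rewrite [RHS]mxE.
  case lN: (tau0 l) => [y|].
    rewrite G0 ?lN// big1// => j _; rewrite !mxE.
    have [fl|_] := eqVneq (f j) l; last by rewrite mulr0.
    by have := free_coord_free c0.2 j; rewrite -/f fl -/tau0 lN.
  have [j fj] : exists j, f j = l by exact: free_coord_onto.
  rewrite (bigD1 j)//= !mxE fj eqxx mulr1 big1 ?addr0// => j' j'j.
  rewrite !mxE -fj (inj_eq (@free_coord_inj _ c0.2)) (negPf j'j) mulr0 //.
have : \rank (F *m invmx A) = p.
  rewrite mxrankMfree ?row_free_unit ?unitmx_inv//.
  exact/eqP/oframe_free.
move=> rk; rewrite /row_free eqn_leq rank_leq_row /= -[X in (X <= _)%N]rk.
rewrite [X in (\rank X <= _)%N]E ?mxrankM_maxl// => i l.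
exact: frame_col_nonfree.
Qed.

End OrientedSmallCube.
End Boxes.

(** * Local unisolvence *)

Definition polyform (R : realType) n p (w : pform R n p) : Prop :=
  forall v, polyfun (fun x => w x v).

Section LinearIntegral.
Variables (R : realType) (n p : nat).

Lemma polyform_sum (I : Type) (r : seq I) (a : I -> R) (w : I -> pform R n p) :
  (forall i, polyform (w i)) ->
  polyform (fun x v => \sum_(i <- r) a i * w i x v).
Proof.
move=> pw v; apply: polyfun_sum => i; apply: polyfunM; last exact: pw.
exact: polyfun_cst.
Qed.

Lemma cell_integral_sum u (o : oriented_cell p u) (I : Type) (r : seq I)
    (a : I -> R) (w : I -> pform R n p) : (forall i, polyform (w i)) ->
  cell_integral o (fun x v => \sum_(i <- r) a i * w i x v)
  = \sum_(i <- r) a i * cell_integral o (w i).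
Proof.
move=> pw; have pfw i v : polyfun (fun t => w i (obase o + t *m oframe o) v).
  exact: polyfun_affine _ _ (pw i v).
rewrite /cell_integral cube_integral_sum; last first.
  by move=> i; apply: polyfunM => //; exact: polyfun_cst.
rewrite mulr_sumr; apply: eq_bigr => i _; rewrite cube_integralZ//.
by rewrite mulrCA.
Qed.

Lemma polyform_pullback A b (w : pform R n p) :
  polyform w -> polyform (pullback_inv A b w).
Proof.
move=> pw v; rewrite /pullback_inv.
have -> : (fun x => w ((x - b) *m invmx A) (v *m invmx A))
  = (fun x => w (- b *m invmx A + x *m invmx A) (v *m invmx A)).
  by apply/funext => x; rewrite -mulmxDl addrC.
exact: (polyfun_affine _ _ (pw _)).
Qed.

Lemma pullback_inv_sum A b (I : Type) (r : seq I) (a : I -> R)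
    (w : I -> pform R n p) :
  pullback_inv A b (fun x v => \sum_(i <- r) a i * w i x v)
  = fun x v => \sum_(i <- r) a i * pullback_inv A b (w i) x v.
Proof. by []. Qed.

End LinearIntegral.

Section LocalUnisolvence.
Variables (R : realType) (n k : nat).
Hypothesis k_gt0 : (0 < k)%N.

Lemma polyform_cube_form p (c : small_index n k p) : polyform (cube_form R c).
Proof.
move=> v; under eq_fun do rewrite cube_formE//; apply: polyfunM.
  by apply: polyfun_prod => l; exact: polyfun_horner.
exact: polyfun_cst.
Qed.

Lemma prod_matching p (tau : cface n) (g : 'I_p -> 'I_n) (F : 'I_n -> R) :
  face_matching tau (full_face p) g ->
  \prod_l F l = (\prod_(l | tau l != None) F l) * \prod_i F (g i).
Proof.
move=> [gf gi gs]; rewrite (bigID (fun l => tau l != None)); congr (_ * _).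
under eq_bigl do rewrite negbK.
transitivity (\prod_(l in g @: [set: 'I_p]%SET) F l); last first.
  rewrite big_imset /=; first by apply: eq_bigl => i; rewrite inE.
  by move=> i j _ _; apply: gi; rewrite ffunE.
apply: eq_bigl => l; apply/eqP/imsetP => [/gs[i _ <-]|[i _ ->]].
  by exists i; rewrite ?inE.
by apply: gf; rewrite ffunE.
Qed.

(** In the local coordinates the cell is parallel to the axes, so that the
    integral of a product is the product of the integrals. *)
Lemma cell_integral_cube_form A b p (c0 c : small_index n k p) u
    (o : oriented_cell p u) :
  A \in unitmx -> u = affine_map A b @` small_cube R c0 ->
  cell_integral o (pullback_inv A b (cube_form R c))
  = cell_scale A c0 o * \prod_l pairing R (box_of c l) (box_of c0 l).
Proof.
move=> Au uE; rewrite /cell_integral /cell_scale -mulrA; congr (_ * _).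
have [g [e [gm loc]]] := local_param k_gt0 Au o uE.
have [gf gi gs] := gm.
set F := oframe o.
have formE t : pullback_inv A b (cube_form R c) (obase o + t *m F) F
  = \det (colsub (free_coord c.2) (F *m invmx A))
    * \prod_l (bern R (box_of c l)).[local_coord A b o t 0 l].
  by rewrite /pullback_inv cube_formE// mulrC.
have [cc0|cc0] := eqVneq (free_coords (val c.2)) (free_coords (val c0.2)).
  have cfree l : sfree (box_of c l) = (val c0.2 l == None).
    by have /setP/(_ l) := cc0; rewrite !inE ffunE sfree_scell_of.
  have c0free l : sfree (box_of c0 l) = (val c0.2 l == None).
    by rewrite ffunE sfree_scell_of.
  pose D := \det (colsub (free_coord c0.2) (F *m invmx A)).
  pose C := \prod_(l | val c0.2 l != None) pairing R (box_of c l) (box_of c0 l).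
  transitivity (cube_integral (fun t => D * C * \prod_i
      ((bern R (box_of c (g i)) \Po spos R (box_of c0 (g i))) \Po flip_poly R (e i)).[t 0 i])).
    apply: cube_integral_ext => t t01; rewrite formE -mulrA (eq_free_coord cc0).
    congr (_ * _); rewrite (prod_matching _ gm); have [loc1 loc2] := loc t t01.
    congr (_ * _).
      apply: eq_bigr => l lN; rewrite pairing_nonfree ?loc2//.
        by rewrite cfree; exact/negbTE.
      by rewrite c0free; exact/negbTE.
    by apply: eq_bigr => i _; rewrite loc1 !horner_comp horner_flip.
  rewrite cube_integral_prod -mulrA; congr (_ * _).
  rewrite (prod_matching _ gm); congr (_ * _); apply: eq_bigr => i _.
  rewrite poly_integral_flip /pairing cfree c0free gf ?ffunE//.
  by rewrite eqxx mul1r.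
have [l lc lc0] : exists2 l, val c.2 l = None & val c0.2 l != None.
  have : ~~ (free_coords (val c.2) \subset free_coords (val c0.2)).
    apply: contra cc0 => sub; rewrite eqEcard sub.
    have /eqP -> := valP c.2; have /eqP -> := valP c0.2; exact: leqnn.
  by move=> /subsetPn[l]; rewrite !inE => /eqP lc lc0; exists l.
rewrite (bigD1 l)//= pairing_cross ?mul0r ?mulr0; last first.
  by rewrite !ffunE !sfree_scell_of lc (negPf lc0).
have [i fi] := free_coord_onto lc.
have D0 : \det (colsub (free_coord c.2) (F *m invmx A)) = 0.
  apply: (det_zero_col (j := i)) => j; rewrite [LHS]mxE fi.
  exact: (frame_col_nonfree k_gt0 Au o uE).
transitivity (cube_integral (fun t : 'rV[R]_p => 0 * \prod_(j < p) (1 : {poly R}).[t 0 j])).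
  by apply: cube_integral_ext => t _; rewrite formE D0 !mul0r.
by rewrite cube_integral_prod mul0r.
Qed.

Lemma cell_integral_self_neq0 A b p (c : small_index n k p) u
    (o : oriented_cell p u) :
  A \in unitmx -> u = affine_map A b @` small_cube R c ->
  cell_integral o (pullback_inv A b (cube_form R c)) != 0.
Proof.
move=> Au uE; rewrite (cell_integral_cube_form _ _ Au uE).
apply: mulf_neq0; first exact: (cell_scale_neq0 k_gt0 Au o uE).
by rewrite gt_eqF// prodr_gt0// => l _; exact: pairing_diag_gt0.
Qed.

(** The matrix of integrals is a tensor power of the invertible one-dimensional
    one; applying the inverse isolates the coefficient of each box. *)
Lemma cube_form_coef A b p (J : Type) (r : seq J) (a : J -> R)
    (c : J -> small_index n k p)
    (o : forall d : small_index n k p,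
           oriented_cell p (affine_map A b @` small_cube R d)) :
  A \in unitmx ->
  (forall d, cell_integral (o d) (pullback_inv A b
     (fun x v => \sum_(j <- r) a j * cube_form R (c j) x v)) = 0) ->
  forall e, \sum_(j <- r | box_of (c j) == e) a j = 0.
Proof.
move=> Au int0 e.
have pair0 (D : box n k) :
    \sum_(j <- r) a j * \prod_l pairing R (box_of (c j) l) (D l) = 0.
  have [Dp|Dp] := eqVneq #|box_free D| p.
    have [d dD] := box_ofP k_gt0 Dp; have := int0 d.
    rewrite pullback_inv_sum cell_integral_sum; last first.
      by move=> j; apply: polyform_pullback; exact: polyform_cube_form.
    under eq_bigr => j _ do
      rewrite (cell_integral_cube_form (c j) _ Au (erefl _)) mulrCA dD.
    rewrite -mulr_sumr => /eqP; rewrite mulf_eq0.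
    by rewrite (negPf (cell_scale_neq0 k_gt0 Au (o d) (erefl _))) => /eqP.
  rewrite big1// => j _.
  have [l lD] : exists l, sfree (box_of (c j) l) != sfree (D l).
    apply/existsP; rewrite -negb_forall; apply: contra Dp => /forallP E.
    rewrite -(card_box_free (c j)); apply/eqP/eq_card => l.
    by rewrite !inE (eqP (E l)).
  by rewrite (bigD1 l)//= pairing_cross// mul0r mulr0.
have [L LP] := pairing_dual R k_gt0.
transitivity (\sum_(D : box n k) (\prod_l L (D l) (e l)) *
    \sum_(j <- r) a j * \prod_l pairing R (box_of (c j) l) (D l)); last first.
  by rewrite big1// => D _; rewrite pair0 mulr0.
under [RHS]eq_bigr do rewrite mulr_sumr; rewrite exchange_big big_mkcond /=.
apply: eq_bigr => j _.
transitivity (a j * \prod_l \sum_d pairing R (box_of (c j) l) d * L d (e l)).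
  under eq_bigr do rewrite LP.
  case: eqVneq => [->|ne]; first by rewrite big1 ?mulr1// => l _; rewrite eqxx.
  have [l lN] : exists l, box_of (c j) l != e l.
    apply/existsP; rewrite -negb_forall; apply: contra ne => /forallP E.
    by apply/eqP/ffunP => l; exact/eqP.
  by rewrite (bigD1 l)//= (negPf lN) mul0r mulr0.
rewrite bigA_distr_bigA mulr_sumr; apply: eq_bigr => D _.
by rewrite mulrCA; congr (_ * _); rewrite big_split mulrC.
Qed.

Lemma cube_form_sum0 A b p (J : Type) (r : seq J) (a : J -> R)
    (c : J -> small_index n k p)
    (o : forall d : small_index n k p,
           oriented_cell p (affine_map A b @` small_cube R d)) :
  A \in unitmx ->
  (forall d, cell_integral (o d) (pullback_inv A b
     (fun x v => \sum_(j <- r) a j * cube_form R (c j) x v)) = 0) ->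
  forall x v, \sum_(j <- r) a j * cube_form R (c j) x v = 0.
Proof.
move=> Au int0 x v.
have coef0 := cube_form_coef Au int0.
rewrite (partition_big (fun j => box_of (c j)) predT)//= big1// => e _.
case: (pickP (fun d : small_index n k p => box_of d == e)) => [d /eqP de|no].
  transitivity ((\sum_(j <- r | box_of (c j) == e) a j) * cube_form R d x v).
    rewrite mulr_suml; apply: eq_bigr => j /eqP je.
    by rewrite (@eq_cube_form R n k k_gt0 p (c j) d)// je de.
  by rewrite coef0 mul0r.
by rewrite big1// => j; rewrite no.
Qed.

End LocalUnisolvence.

(** * Traces on common faces *)

Section ScellFlip.
Variables (R : realType) (k : nat).
Hypothesis k_gt0 : (0 < k)%N.
Implicit Types d : scell k.

Let k_pos : 0 < k%:R :> R. Proof. by rewrite ltr0n. Qed.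
Let k0 : k%:R != 0 :> R. Proof. by rewrite pnatr_eq0 -lt0n. Qed.

Definition flip_scell (e : bool) d : scell k :=
  if e then match d with inl m => inl (rev_ord m) | inr m => inr (rev_ord m) end
  else d.

Lemma slo_flip d : slo (flip_scell true d) = shi d.
Proof. by case: d => m //=; have := ltn_ord m; lia. Qed.

Lemma shi_flip d : shi (flip_scell true d) = slo d.
Proof. by case: d => m /=; have := ltn_ord m; lia. Qed.

Lemma sfree_flip e d : sfree (flip_scell e d) = sfree d.
Proof. by case: e; case: d. Qed.

Lemma in_scell_flip e d (z : R) :
  in_scell (flip_scell e d) (flip e z) = in_scell d z.
Proof.
case: e => //; rewrite /in_scell slo_flip shi_flip /flip andbC.
by congr (_ && _); apply/idP/idP; lra.
Qed.

Lemma bern_flip e d (z : R) :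
  (bern R (flip_scell e d)).[flip e z] = (bern R d).[z].
Proof.
case: e => //; rewrite !horner_bpoly slo_flip shi_flip /flip mulrC.
by rewrite opprB addrC subrK.
Qed.

Lemma in_scell_itv d (z : R) : in_scell d z -> 0 <= z <= 1.
Proof.
move=> /andP[z1 z2]; apply/andP; split; first by apply: le_trans z1; exact: divr_ge0.
by apply: (le_trans z2); rewrite lerBlDr lerDl divr_ge0.
Qed.

Lemma in_scell_spos d (x : R) : 0 <= x <= 1 -> in_scell d (spos R d).[x].
Proof. by move=> x01; apply/(in_scellP k_gt0); exists x. Qed.

Lemma spos_neq d : sfree d -> (spos R d).[0] != (spos R d).[1].
Proof.
rewrite /spos => ->; rewrite !hornerE (inj_eq (mulfI _)) ?invr_eq0//.
by rewrite -subr_eq0 opprD addNKr oppr_eq0 oner_eq0.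
Qed.

Lemma scell_eq d d' : slo d = slo d' -> shi d = shi d' -> d = d'.
Proof.
have inlr (m : 'I_k.+1) (m' : 'I_k) : m = m' :> nat -> (k - m)%N = (k.-1 - m')%N ->
    False.
  move=> ->; have := ltn_ord m'; lia.
case: d d' => m [] m' /= mm' E.
- by congr inl; exact/val_inj.
- by case: (inlr _ _ mm' E).
- by case: (inlr m' m (esym mm') (esym E)).
- by congr inr; exact/val_inj.
Qed.

(** The end points of the cell recover lo and hi. *)
Lemma scell_ext d d' : (forall z : R, in_scell d z <-> in_scell d' z) -> d = d'.
Proof.
have ends (D : scell k) : in_scell D ((slo D)%:R / k%:R : R) /\
    in_scell D (1 - (shi D)%:R / k%:R : R).
  have le : (slo D)%:R / k%:R <= 1 - (shi D)%:R / k%:R :> R.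
    by rewrite shi_eq// ler_pM2r ?invr_gt0// lerDl ler0n.
  by split; apply/andP; split.
have bounds (D D' : scell k) : (forall z : R, in_scell D z -> in_scell D' z) ->
    (slo D' <= slo D)%N /\ (shi D' <= shi D)%N.
  move=> DD'; have [/DD' /andP[lo _] /DD' /andP[_ hi]] := ends D; split.
    by move: lo; rewrite ler_pM2r ?invr_gt0// ler_nat.
  by move: hi; rewrite lerD2l lerN2 ler_pM2r ?invr_gt0// ler_nat.
move=> dd'; have [l1 h1] := bounds d d' (fun z => (dd' z).1).
have [l2 h2] := bounds d' d (fun z => (dd' z).2).
by apply: scell_eq; apply/eqP; rewrite eqn_leq ?l1 ?l2 ?h1 ?h2.
Qed.

Definition end_scell (y : bool) : scell k := inl (if y then ord_max else ord0).

Lemma in_end_scell y (z : R) : in_scell (end_scell y) z = (z == y%:R).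
Proof.
rewrite /in_scell shi_eq// addr0 -eq_le eq_sym.
by case: y; rewrite /= ?divff ?mul0r.
Qed.

Lemma bern_end y : (bern R (end_scell y)).[y%:R] = 1.
Proof.
rewrite horner_bpoly /=; case: y; rewrite /= ?subnn ?subn0 expr0 ?mulr1 ?mul1r.
  by rewrite expr1n.
by rewrite subr0 expr1n.
Qed.

Lemma end_scellP d (y : bool) :
  (forall z : R, in_scell d z -> z = y%:R) -> d = end_scell y.
Proof.
move=> dy; apply: scell_ext => z; rewrite in_end_scell.
split=> [/dy ->//|/eqP ->].
have d0 : in_scell d (spos R d).[0] by apply: in_scell_spos; rewrite lexx ler01.
by rewrite -(dy _ d0).
Qed.

Lemma bern_end0 d (y : bool) (z : R) :
  sfree d = false -> in_scell d z -> z != y%:R -> (bern R d).[y%:R] = 0.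
Proof.
case: d => // m _ zm zy; rewrite horner_bpoly /=.
have {zm}zE : z = m%:R / k%:R.
  by apply/esym/le_anti; move: zm; rewrite /in_scell shi_eq//= addr0.
rewrite zE in zy; case: y zy => zy; rewrite ?subrr ?subr0 expr0n.
  rewrite subn_eq0 leqNgt ltn_neqAle leq_ord andbT.
  have [mk|_] := eqVneq (m : nat) k; last by rewrite mulr0.
  by move: zy; rewrite mk divff ?eqxx.
have [m0|_] := eqVneq (m : nat) 0%N; last by rewrite mul0r.
by move: zy; rewrite m0 mul0r eqxx.
Qed.

End ScellFlip.

(** Such a matrix is orthogonal. *)
Lemma det_signed_perm (R : realType) p (q : 'I_p -> 'I_p) (e : 'I_p -> bool) :
  injective q ->
  \det (\matrix_(i, j) ((-1) ^+ e j * (i == q j)%:R) : 'M[R]_p) ^+ 2 = 1.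
Proof.
move=> qI; set S := \matrix_(i, j) _.
rewrite expr2 -{1}det_tr -det_mulmx -[RHS](det1 R p); congr (\det _).
apply/matrixP => i j; rewrite !mxE (bigD1 (q i))//= big1 => [|l li].
  rewrite !mxE eqxx mulr1 addr0 (inj_eq qI).
  case: (eqVneq i j) => [->|ij]; last by rewrite !mulr0.
  by rewrite mulr1 -expr2 sqrr_sign.
by rewrite !mxE (negPf li) mulr0 mul0r.
Qed.

Lemma matching_inv n (tau tau' : cface n) g : face_matching tau tau' g ->
  exists h, (forall i, tau i = None -> tau' (h i) = None /\ g (h i) = i) /\
            (forall l, tau' l = None -> h (g l) = l).
Proof.
move=> [gf gi gs].
have /choice[h hP] (i : 'I_n) : exists l, tau i = None -> tau' l = None /\ g l = i.
  case E: (tau i) => [y|]; first by exists i.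
  by have [l ? ?] := gs i E; exists l.
exists h; split=> // l lN; have [hN gh] := hP _ (gf _ lN).
by apply: gi.
Qed.

Section SharedFace.
Variables (R : realType) (n k : nat).
Hypothesis k_gt0 : (0 < k)%N.
Variables (A1 A2 : 'M[R]_n) (b1 b2 : 'rV[R]_n) (rho1 rho2 : cface n).
Hypotheses (A1_unit : A1 \in unitmx) (A2_unit : A2 \in unitmx).
Hypothesis shared : image_face A1 b1 rho1 = image_face A2 b2 rho2.

Lemma affine_inj (A : 'M[R]_n) b : A \in unitmx -> injective (affine_map A b).
Proof.
move=> Au x y /addIr; apply: row_free_inj; by rewrite row_free_unit.
Qed.

Lemma shared_transition : exists g e, face_matching rho1 rho2 g /\
  forall x y, face_set R rho1 x -> face_set R rho2 y ->
    affine_map A1 b1 x = affine_map A2 b2 y ->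
    forall l, rho2 l = None -> y 0 l = flip (e l) (x 0 (g l)).
Proof.
have [| |//||g [e [gm ge]]] := @face_transition R n n n rho1 rho2 b1 b2 A1 A2.
- by rewrite row_free_unit.
- by rewrite row_free_unit.
- move: shared; rewrite /image_face /affine_map.
  by under eq_imagel do rewrite addrC; under [RHS]eq_imagel do rewrite addrC.
exists g, e; split=> // x y tx ty xy; apply: ge => //.
by rewrite ![_ + _ *m _]addrC.
Qed.

Variables (g h : 'I_n -> 'I_n) (e : 'I_n -> bool).
Hypothesis gm : face_matching rho1 rho2 g.
Hypothesis rel : forall x y, face_set R rho1 x -> face_set R rho2 y ->
    affine_map A1 b1 x = affine_map A2 b2 y ->
    forall l, rho2 l = None -> y 0 l = flip (e l) (x 0 (g l)).
Hypothesis hP : forall i, rho1 i = None -> rho2 (h i) = None /\ g (h i) = i.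
Hypothesis hg : forall l, rho2 l = None -> h (g l) = l.

Lemma shared12 x : face_set R rho1 x ->
  exists2 y, face_set R rho2 y & affine_map A1 b1 x = affine_map A2 b2 y.
Proof.
move=> tx; have : image_face A1 b1 rho1 (affine_map A1 b1 x) by exists x.
by rewrite shared => -[y ty xy]; exists y.
Qed.

Lemma shared21 y : face_set R rho2 y ->
  exists2 x, face_set R rho1 x & affine_map A1 b1 x = affine_map A2 b2 y.
Proof.
move=> ty; have : image_face A2 b2 rho2 (affine_map A2 b2 y) by exists y.
by rewrite -shared => -[x tx xy]; exists x.
Qed.

Section ShareCube.
Variables (p : nat) (c2 : small_index n k p).
Hypothesis c2_face : small_cube R c2 `<=` face_set R rho2.

(** Permutations and reflections of the coordinates preserve the grid of small
    cubes of the common face. *)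
Lemma small_cube_transfer : exists c1 : small_index n k p,
  affine_map A1 b1 @` small_cube R c1 = affine_map A2 b2 @` small_cube R c2.
Proof.
pose D := box_of c2.
pose C : box n k := [ffun l => if rho1 l is Some y then end_scell k y
                               else flip_scell (e (h l)) (D (h l))].
have base_in (s : 'I_n -> R) : (forall l, 0 <= s l <= 1) ->
    small_cube R c2 (\row_l (spos R (D l)).[s l]).
  move=> s01; apply/(small_cubeP k_gt0 _ _) => l; rewrite mxE.
  exact: in_scell_spos.
have Dfix l y : rho2 l = Some y -> in_scell (D l) (y%:R : R) /\ sfree (D l) = false.
  move=> ly.
  have pt (s : bool) : (spos R (D l)).[s%:R] = y%:R.
    have s01 (i : 'I_n) : 0 <= (s%:R : R) <= 1 by case: s; rewrite ?lexx ler01.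
    by have := c2_face (base_in (fun=> s%:R) s01) l; rewrite ly mxE.
  split; first by rewrite -(pt false) in_scell_spos// lexx ler01.
  apply/negP => /(@spos_neq R k k_gt0)/eqP; apply.
  by rewrite (pt false) (pt true).
have Dfree l : sfree (D l) -> rho2 l = None.
  by case E: (rho2 l) => [y|//]; have [_ ->] := Dfix l y E.
have [c1 c1C] : exists c1 : small_index n k p, box_of c1 = C.
  apply: box_ofP => //; rewrite -(card_box_free c2) -/D.
  have -> : box_free D = (h @: box_free C)%SET.
    apply/setP => l; rewrite inE; apply/idP/imsetP => [lD|[i]].
      have lN := Dfree l lD; exists (g l); last by rewrite hg.
      have [gf _ _] := gm.
      by rewrite inE ffunE gf// sfree_flip hg.
    by rewrite inE ffunE; case: (rho1 i) => // + -> ; rewrite sfree_flip.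
  rewrite card_in_imset// => i j; rewrite !inE !ffunE.
  case Ei: (rho1 i) => //; case Ej: (rho1 j) => // _ _ hij.
  by have [_ <-] := hP Ei; have [_ <-] := hP Ej; rewrite hij.
exists c1; apply/seteqP; split=> _ [z zc <-].
- have zC : forall l, in_scell (C l) (z 0 l).
    by move: zc => /(small_cubeP k_gt0 _ _); rewrite c1C.
  have tz : face_set R rho1 z.
    move=> l; have := zC l; rewrite ffunE; case: (rho1 l) => [y|].
      by rewrite in_end_scell// => /eqP.
    exact: in_scell_itv.
  have [y ty zy] := shared12 tz; exists y => //.
  apply/(small_cubeP k_gt0 _ _) => l; rewrite -/D; case lE: (rho2 l) => [y0|].
    by have := ty l; rewrite lE => ->; have [] := Dfix l y0 lE.
  rewrite (rel tz ty zy lE); have := zC (g l); rewrite ffunE.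
  have [gf _ _] := gm; rewrite gf// hg// => Cz.
  by rewrite -(in_scell_flip k_gt0 (e l)) flipK.
- have tz := c2_face zc; have [x tx xz] := shared21 tz; exists x => //.
  apply/(small_cubeP k_gt0 _ _) => l; rewrite c1C ffunE.
  case lE: (rho1 l) => [y|].
    by have := tx l; rewrite lE in_end_scell// => ->.
  have [hN gh] := hP lE.
  have zl := rel tx tz xz hN; rewrite gh in zl.
  rewrite -[x 0 l](flipK (e (h l))) -zl in_scell_flip//.
  by move: zc => /(small_cubeP k_gt0 _ _).
Qed.

End ShareCube.

Section ShareForm.
Variables (p : nat) (c1 c2 : small_index n k p).
Hypothesis c12 : affine_map A1 b1 @` small_cube R c1
                 = affine_map A2 b2 @` small_cube R c2.
Hypothesis c1_face : small_cube R c1 `<=` face_set R rho1.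
Hypothesis c2_face : small_cube R c2 `<=` face_set R rho2.

Lemma small_coord q (c : small_index n k q) l (z : R) : in_scell (box_of c l) z ->
  exists2 x : 'rV[R]_n, small_cube R c x & x 0 l = z.
Proof.
move=> lz.
exists (\row_j if j == l then z else (spos R (box_of c j)).[0]).
  apply/(small_cubeP k_gt0 _ _) => j; rewrite mxE; case: eqVneq => [->//|_].
  by apply: in_scell_spos; rewrite // lexx ler01.
by rewrite mxE eqxx.
Qed.

Lemma box_end q (c : small_index n k q) rho : small_cube R c `<=` face_set R rho ->
  forall l y, rho l = Some y -> box_of c l = end_scell k y.
Proof.
move=> cf l y ly; apply: (@end_scellP R k k_gt0) => z /small_coord[x cx <-].
by have := cf _ cx l; rewrite ly.
Qed.

Lemma box_transition l : rho2 l = None ->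
  box_of c1 (g l) = flip_scell (e l) (box_of c2 l).
Proof.
move=> lN; apply: (@scell_ext R k k_gt0) => z.
rewrite -[z](flipK (e l)) in_scell_flip// flipK.
split=> [/small_coord[x cx xz]|/small_coord[y cy yz]].
  have : (affine_map A1 b1 @` small_cube R c1) (affine_map A1 b1 x) by exists x.
  rewrite c12 => -[y cy /esym xy].
  have := rel (c1_face cx) (c2_face cy) xy lN; rewrite xz => <-.
  exact: (small_cubeP k_gt0 _ _).1.
have : (affine_map A2 b2 @` small_cube R c2) (affine_map A2 b2 y) by exists y.
rewrite -c12 => -[x cx xy].
have := rel (c1_face cx) (c2_face cy) xy lN; rewrite yz => /(can_inj (@flipK R _)).
by move=> ->; exact: (small_cubeP k_gt0 _ _).1.
Qed.

(** The sign is the one of the signed permutation relating the free directions;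
    on the face the factors in the other directions are 1. *)
Lemma form_transition : exists2 s : R, s ^+ 2 = 1 &
  forall x y (V W : 'M[R]_(p, n)), face_set R rho1 x -> face_set R rho2 y ->
    affine_map A1 b1 x = affine_map A2 b2 y ->
    (forall i l, rho2 l = None -> W i l = (-1) ^+ e l * V i (g l)) ->
    cube_form R c1 x V = s * cube_form R c2 y W.
Proof.
have [gf gi gs] := gm.
have c2free i : rho2 (free_coord c2.2 i) = None.
  case E: (rho2 _) => [y|//]; have := box_end c2_face E.
  by rewrite ffunE free_coord_free.
have sf l : rho2 l = None -> (val c1.2 (g l) == None) = (val c2.2 l == None).
  move=> lN; have := congr1 (@sfree k) (box_transition lN).
  by rewrite sfree_flip !ffunE !sfree_scell_of.
have /choice[q qP] (i : 'I_p) : exists j, free_coord c1.2 j = g (free_coord c2.2 i).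
  apply: free_coord_onto; apply/eqP; rewrite sf ?c2free//.
  by rewrite free_coord_free.
have qI : injective q.
  move=> i j qij; apply: (@free_coord_inj _ _ c2.2); apply: gi => //.
  by rewrite -!qP qij.
pose S : 'M[R]_p := \matrix_(i, j) ((-1) ^+ e (free_coord c2.2 j) * (i == q j)%:R).
exists (\det S); first exact: det_signed_perm.
move=> x y V W tx ty xy VW; rewrite !cube_formE// mulrCA.
have -> : colsub (free_coord c2.2) W = colsub (free_coord c1.2) V *m S.
  apply/matrixP => i j; rewrite !mxE VW// (bigD1 (q j))//= !mxE eqxx mulr1 big1.
    by rewrite addr0 qP mulrC.
  by move=> l lj; rewrite !mxE (negPf lj) !mulr0.
rewrite det_mulmx [\det S * _]mulrC -!mulrA -expr2 det_signed_perm// mulr1.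
congr (_ * _).
rewrite (bigID (fun l => rho1 l == None)) [RHS](bigID (fun l => rho2 l == None)) /=.
rewrite [X in _ * X]big1 ?mulr1 => [|l].
  rewrite [X in _ = _ * X]big1 ?mulr1 => [|l].
    rewrite (reindex_onto g h) => [|i /eqP iN]; last by have [] := hP iN.
    apply: eq_big => [l|l /andP[/eqP gN /eqP hgl]].
      apply/andP/eqP => [[/eqP gN /eqP <-]|lN]; first by have [] := hP gN.
      by rewrite gf// hg// !eqxx.
    have lN : rho2 l = None by rewrite -hgl; have [] := hP gN.
    rewrite box_transition// (rel tx ty xy lN).
    by rewrite -[x 0 (g l)](flipK (e l)) bern_flip// flipK.
  by have := ty l; case E: (rho2 l) => [y0|//] -> _; rewrite (box_end c2_face E) bern_end.
by have := tx l; case E: (rho1 l) => [y0|//] -> _; rewrite (box_end c1_face E) bern_end.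
Qed.

End ShareForm.
End SharedFace.

Section FormVanish.
Variables (R : realType) (n k : nat).
Hypothesis k_gt0 : (0 < k)%N.

Lemma box_of_small_cube p (c d : small_index n k p) :
  small_cube R c = small_cube R d -> box_of c = box_of d.
Proof.
move=> cd; apply/ffunP => l; apply: (@scell_ext R k k_gt0) => z.
split=> /(small_coord k_gt0)[x xc <-].
  by rewrite cd in xc; exact: (small_cubeP k_gt0 _ _).1 xc l.
by rewrite -cd in xc; exact: (small_cubeP k_gt0 _ _).1 xc l.
Qed.

(** On a face that does not contain the small cube, one of the differentials or
    one of the polynomial factors of its form vanishes. *)
Lemma cube_form_vanish p (c : small_index n k p) rho (x : 'rV[R]_n)
    (V : 'M[R]_(p, n)) :
  ~ (small_cube R c `<=` face_set R rho) -> face_set R rho x ->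
  (forall i l, rho l != None -> V i l = 0) -> cube_form R c x V = 0.
Proof.
move=> /existsNP[x0 /not_implyP[cx0 /existsNP[l]]] + xrho V0.
case E: (rho l) => [y|]; last first.
  by case; exact: in_scell_itv ((small_cubeP k_gt0 _ _).1 cx0 l).
move=> /eqP x0y; rewrite cube_formE//.
have := (small_cubeP k_gt0 _ _).1 cx0 l; have := xrho l; rewrite E => xl cl.
case lF: (sfree (box_of c l)).
  have [|i il] := @free_coord_onto n p c.2 l.
    by move: lF; rewrite ffunE sfree_scell_of => /eqP.
  rewrite [\det _](det_zero_col (j := i)) ?mulr0// => j.
  by rewrite mxE il V0// E.
by rewrite (bigD1 l)//= xl (bern_end0 k_gt0 lF cl x0y) !mul0r.
Qed.

End FormVanish.

Section MeshTraces.
Variables (R : realType) (n : nat) (Omega : set 'rV[R]_n).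
Variables (K : cubical_mesh Omega) (k : nat) (o : orientation K k).
Hypothesis k_gt0 : (0 < k)%N.
Implicit Types i j : mcells K.

Definition cell_coord i (z : 'rV[R]_n) := (z - mtrans i) *m invmx (mlin i).

Lemma cell_coordK i x : cell_coord i (affine_map (mlin i) (mtrans i) x) = x.
Proof. by rewrite /cell_coord addrK mulmxK// mlin_unit. Qed.

Lemma image_face_coord i rho z : image_face (mlin i) (mtrans i) rho z ->
  face_set R rho (cell_coord i z) /\
  affine_map (mlin i) (mtrans i) (cell_coord i z) = z.
Proof. by move=> [x tx <-]; rewrite cell_coordK. Qed.

Lemma image_full_face i : image_face (mlin i) (mtrans i) (full_face n) = mcell i.
Proof. by rewrite /image_face -unit_cubeE. Qed.

Lemma image_face_sub i rho : image_face (mlin i) (mtrans i) rho `<=` mcell i.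
Proof. by move=> _ [x tx <-]; exists x => // l; exact: face_set_itv tx l. Qed.

Lemma mesh_shared i j z : mcell i z -> mcell j z ->
  exists rho rho',
    image_face (mlin i) (mtrans i) rho = image_face (mlin j) (mtrans j) rho' /\
    mcell i `&` mcell j = image_face (mlin i) (mtrans i) rho.
Proof.
move=> iz jz; have := mesh_meet i j (full_face n) (full_face n).
rewrite /= !image_full_face => -[ij0|[[rho [_ E]] [rho' [_ E']]]].
  by exfalso; have : set0 z by rewrite -ij0.
by exists rho, rho'; rewrite -E -E'.
Qed.

Lemma msmall_cube_sub i p (c : small_index n k p) : msmall_cube i c `<=` mcell i.
Proof.
move=> _ [x /(small_cubeP k_gt0) cx <-]; exists x => // l.
exact: in_scell_itv (cx l).
Qed.

Lemma msmall_cube_neq0 i p (c : small_index n k p) : exists z, msmall_cube i c z.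
Proof.
have /(small_cubeP k_gt0) cx (l : 'I_n) :
    in_scell (box_of c l)
      ((\row_l (spos R (box_of c l)).[0] : 'rV[R]_n) 0 l).
  by rewrite mxE; apply: in_scell_spos; rewrite // lexx ler01.
by eexists; eexists; first exact: cx.
Qed.

Lemma small_cube_sub_face i p (c : small_index n k p) rho :
  msmall_cube i c `<=` image_face (mlin i) (mtrans i) rho ->
  small_cube R c `<=` face_set R rho.
Proof.
move=> sub x cx; rewrite -(cell_coordK i x).
by have [] := image_face_coord (sub _ (ex_intro2 _ _ x cx erefl)).
Qed.

(** The cell is a small cube of some n-cell, and being contained in [mcell i] it
    lies in the common face of both. *)
Lemma subset_msmall p (u : Kk_cells K k p) i : val u `<=` mcell i ->
  exists c : small_index n k p, val u = msmall_cube i c.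
Proof.
case: u => u uK /=; have := set_mem uK => -[j [d uE]] ui; subst u.
have [z dz] := msmall_cube_neq0 j d.
have [rho [rho' [shared ij]]] := mesh_shared (ui _ dz) (msmall_cube_sub dz).
have d_face : small_cube R d `<=` face_set R rho'.
  apply: (@small_cube_sub_face j); rewrite -shared -ij => x dx.
  by split; [exact: ui|exact: msmall_cube_sub dx].
have [g [e [gm rel]]] := shared_transition (mlin_unit i) (mlin_unit j) shared.
have [h [hP hg]] := matching_inv gm.
have [c cE] := small_cube_transfer k_gt0 shared gm rel hP hg d_face.
by exists c; exact: esym cE.
Qed.

Lemma msmall_cube_box i p (c d : small_index n k p) :
  msmall_cube i c = msmall_cube i d -> box_of c = box_of d.
Proof.
move=> cd; apply: (box_of_small_cube (R := R) k_gt0).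
have inj := @affine_inj R n _ (mtrans i) (mlin_unit i).
apply/seteqP; split=> y yc.
  have : msmall_cube i c (affine_map (mlin i) (mtrans i) y) by exists y.
  by rewrite cd => -[y' ? /inj <-].
have : msmall_cube i d (affine_map (mlin i) (mtrans i) y) by exists y.
by rewrite -cd => -[y' ? /inj <-].
Qed.

Lemma w_formE p (u : Kk_cells K k p) i (c : small_index n k p) :
  val u = msmall_cube i c ->
  w_form o u i =
  let w := pullback_inv (mlin i) (mtrans i) (cube_form R c) in
  fun x v => Num.sg (cell_integral (o u) w) * w x v.
Proof.
move=> uc; apply/funext => x; apply/funext => v; rewrite /w_form.
case: pickP => [d /asboolP ud|/(_ c)/negbT/asboolPn[]//].
rewrite (@eq_cube_form R n k k_gt0 p d c)//; apply: (@msmall_cube_box i).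
by rewrite -uc -ud.
Qed.

Lemma w_form0 p (u : Kk_cells K k p) i :
  ~ (val u `<=` mcell i) -> w_form o u i = fun _ _ => 0.
Proof.
move=> ui; apply/funext => x; apply/funext => v; rewrite /w_form.
case: pickP => // d /asboolP ud; exfalso; apply: ui.
by rewrite ud; exact: msmall_cube_sub.
Qed.

(** A frame tangent to the common face, in a form that is transported by the
    coordinates of either n-cell. *)
Definition tangent_frame i j p (F : 'M[R]_(p, n)) : Prop :=
  forall b, exists z1 z2, [/\ mcell i z1 /\ mcell j z1, mcell i z2 /\ mcell j z2 &
    row b F = z1 - z2].

Lemma oriented_cell_point p (u : set 'rV[R]_n) (ou : oriented_cell p u) t :
  unit_cube R p t -> u (obase ou + t *m oframe ou).
Proof.
move=> t01; have := oriented_cellE ou; move: (obase ou) (oframe ou) => a F ->.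
by exists t => //; rewrite -unit_cubeE.
Qed.

Lemma oriented_cell_tangent p (u : set 'rV[R]_n) (ou : oriented_cell p u) i j :
  u `<=` mcell i -> u `<=` mcell j -> tangent_frame i j (oframe ou).
Proof.
move=> ui uj b.
have p1 := oriented_cell_point ou (@delta_in_cube R p b).
have p0 := oriented_cell_point ou (@zero_in_cube R p).
exists (obase ou + delta_mx 0 b *m oframe ou), (obase ou + 0 *m oframe ou).
split; [by split; [exact: ui|exact: uj]..|].
by rewrite mul0mx addr0 addrAC subrr add0r -rowE.
Qed.

(** If the small cube lies in the common face, the two cubical forms agree there
    up to a sign; the integral over the small cube changes by the same sign. *)
Lemma w_form_trace_le p (u : Kk_cells K k p) i j x (F : 'M[R]_(p, n)) :
  val u `<=` mcell i -> mcell i x -> mcell j x -> tangent_frame i j F ->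
  w_form o u i x F = w_form o u j x F.
Proof.
move=> ui xi xj FT; have [rho [rho' [shared ij]]] := mesh_shared xi xj.
have in1 z : mcell i z -> mcell j z -> image_face (mlin i) (mtrans i) rho z.
  by move=> iz jz; rewrite -ij.
have in2 z : mcell i z -> mcell j z -> image_face (mlin j) (mtrans j) rho' z.
  by move=> iz jz; rewrite -shared -ij.
have frameE q m (z1 z2 : 'rV[R]_n) (G : 'M[R]_(q, n)) b l : row b G = z1 - z2 ->
    (G *m invmx (mlin m)) b l = cell_coord m z1 0 l - cell_coord m z2 0 l.
  move=> Gb; transitivity ((row b G *m invmx (mlin m)) 0 l).
    by rewrite -row_mul [RHS]mxE.
  rewrite Gb -[RHS](_ : (cell_coord m z1 - cell_coord m z2) 0 l = _); last by rewrite !mxE.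
  by rewrite /cell_coord -mulmxBl opprB addrA subrK.
have [c uc] := subset_msmall ui.
have [uj|uj] := pselect (val u `<=` mcell j); last first.
  rewrite (w_form0 uj) (w_formE uc) /pullback_inv /=.
  rewrite (@cube_form_vanish R n k k_gt0 p c rho)// ?mulr0//.
  - move=> c_face; apply: uj; rewrite uc => _ [y cy <-].
    have : image_face (mlin i) (mtrans i) rho (affine_map (mlin i) (mtrans i) y).
      by exists y => //; exact: c_face.
    by rewrite shared; exact: image_face_sub.
  - by have [] := image_face_coord (in1 _ xi xj).
  - move=> b l lN; have [z1 [z2 [[iz1 jz1] [iz2 jz2] /frameE ->]]] := FT b.
    have [t1 _] := image_face_coord (in1 _ iz1 jz1).
    have [t2 _] := image_face_coord (in1 _ iz2 jz2).
    have := t1 l; have := t2 l; case: (rho l) lN => // y _ -> ->.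
    by rewrite subrr.
have [d ud] := subset_msmall uj.
have [g [e [gm rel]]] := shared_transition (mlin_unit i) (mlin_unit j) shared.
have cd : affine_map (mlin i) (mtrans i) @` small_cube R c
        = affine_map (mlin j) (mtrans j) @` small_cube R d.
  by rewrite -[LHS]uc -[RHS]ud.
have c_face : small_cube R c `<=` face_set R rho.
  apply: (@small_cube_sub_face i) => z cz; rewrite -uc in cz.
  exact: in1 (ui _ cz) (uj _ cz).
have d_face : small_cube R d `<=` face_set R rho'.
  apply: (@small_cube_sub_face j) => z dz; rewrite -ud in dz.
  exact: in2 (ui _ dz) (uj _ dz).
have [h [hP hg]] := matching_inv gm.
have [s s1 sE] := form_transition k_gt0 gm rel hP hg cd c_face d_face.
have pull y G : mcell i y -> mcell j y -> tangent_frame i j G ->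
    pullback_inv (mlin i) (mtrans i) (cube_form R c) y G
    = s * pullback_inv (mlin j) (mtrans j) (cube_form R d) y G.
  move=> iy jy GT; have [t1 e1] := image_face_coord (in1 _ iy jy).
  have [t2 e2] := image_face_coord (in2 _ iy jy).
  apply: sE => //; first by rewrite e1 e2.
  move=> b l lN; have [z1 [z2 [[iz1 jz1] [iz2 jz2] Gb]]] := GT b.
  rewrite !(frameE _ _ _ _ _ _ _ Gb).
  have [p1 q1] := image_face_coord (in1 _ iz1 jz1).
  have [p1' q1'] := image_face_coord (in2 _ iz1 jz1).
  have [p2 q2] := image_face_coord (in1 _ iz2 jz2).
  have [p2' q2'] := image_face_coord (in2 _ iz2 jz2).
  rewrite (rel _ _ p1 p1' (etrans q1 (esym q1')) l lN).
  rewrite (rel _ _ p2 p2' (etrans q2 (esym q2')) l lN).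
  by case: (e l); rewrite /flip ?expr1 ?expr0; ring.
have int_s : cell_integral (o u) (pullback_inv (mlin i) (mtrans i) (cube_form R c))
   = s * cell_integral (o u) (pullback_inv (mlin j) (mtrans j) (cube_form R d)).
  rewrite /cell_integral mulrCA -(cube_integralZ s); last first.
    apply: (polyfun_affine _ _ (@polyform_pullback _ _ _ _ _ _ _ _)).
    exact: polyform_cube_form.
  congr (_ * _); apply: cube_integral_ext => t t01.
  have ut := oriented_cell_point (o u) t01.
  by apply: pull; [exact: ui|exact: uj|exact: oriented_cell_tangent].
rewrite (w_formE uc) (w_formE ud) /= int_s pull//.
move/eqP: s1; rewrite sqrf_eq1 => /orP[]/eqP ->; first by rewrite !mul1r.
by rewrite !mulN1r sgrN mulrNN.
Qed.

Lemma w_form_trace p (u : Kk_cells K k p) i j x (F : 'M[R]_(p, n)) :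
  mcell i x -> mcell j x -> tangent_frame i j F ->
  w_form o u i x F = w_form o u j x F.
Proof.
move=> xi xj FT; have FT' : tangent_frame j i F.
  by move=> b; have [z1 [z2 [[? ?] [? ?] ?]]] := FT b; exists z1, z2.
have [ui|ui] := pselect (val u `<=` mcell i); first exact: w_form_trace_le.
have [uj|uj] := pselect (val u `<=` mcell j).
  by apply/esym; exact: w_form_trace_le.
by rewrite !w_form0.
Qed.

Lemma cubical_trace p (w : pwform K p) (u : Kk_cells K k p) i j :
  cubical_forms o w -> val u `<=` mcell i -> val u `<=` mcell j ->
  cell_integral (o u) (w i) = cell_integral (o u) (w j).
Proof.
move=> [s [a ->]] ui uj; rewrite /cell_integral; congr (_ * _); apply: cube_integral_ext => t t01.
have ut := oriented_cell_point (o u) t01.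
apply: eq_bigr => u' _; congr (_ * _); apply: w_form_trace.
- exact: ui.
- exact: uj.
- exact: oriented_cell_tangent.
Qed.

Lemma de_RhamE p (w : pwform K p) (u : Kk_cells K k p) i :
  cubical_forms o w -> val u `<=` mcell i ->
  de_Rham o w u = cell_integral (o u) (w i).
Proof.
move=> wQ ui; rewrite /de_Rham; case: pickP => [j /asboolP uj|/(_ i)/negbT/asboolPn[]//].
exact: cubical_trace.
Qed.

End MeshTraces.

(** * Stokes' theorem on oriented cells *)

Section Stokes.
Variables (R : realType) (n : nat).

(** Alternation and multilinearity, in the form that a change of frame uses. *)
Definition frame_law p (w : pform R n p) : Prop :=
  forall x (N : 'M[R]_p) G, w x (N *m G) = \det N * w x G.

Lemma derive_affine p (f : 'rV[R]_n -> R) a (F : 'M[R]_(p, n)) t i :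
  'D_(row i F) f (a + t *m F) = 'D_(delta_mx 0 i) (fun s => f (a + s *m F)) t.
Proof.
rewrite /derive.
suff -> : (fun h => h^-1 *: ((f \o shift (a + t *m F)) (h *: row i F) - f (a + t *m F)))
  = (fun h => h^-1 *: (((fun s => f (a + s *m F)) \o shift t) (h *: delta_mx 0 i)
                      - f (a + t *m F))) by [].
apply/funext => h /=; congr (_ *: (f _ - _)).
by rewrite mulmxDl -scalemxAl -rowE addrCA.
Qed.

Lemma insert_coord_mul p (i : 'I_p.+1) c (t : 'rV[R]_p) (F : 'M[R]_(p.+1, n)) :
  insert_coord i c t *m F = c *: row i F + t *m row' i F.
Proof.
apply/rowP => j; rewrite !mxE (bigD1_ord i) //= !mxE unlift_none; congr (_ + _).
by apply: eq_bigr => l _; rewrite !mxE liftK.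
Qed.

(** The i-th term of the exterior derivative is the partial derivative in the
    i-th parameter, whose integral is the difference of two facets. *)
Lemma cube_stokes p (w : pform R n p) a (F : 'M[R]_(p.+1, n)) : polyform w ->
  cube_integral (fun t => exterior_derivative w (a + t *m F) F)
  = \sum_(i < p.+1) \sum_(b : bool) (-1) ^+ i * (-1) ^+ (~~ b) *
      cube_integral (fun t => w (a + b%:R *: row i F + t *m row' i F) (row' i F)).
Proof.
move=> pw.
have pf i : polyfun (fun t => w (a + t *m F) (row' i F)).
  exact: (polyfun_affine _ _ (pw _)).
transitivity (cube_integral (fun t => \sum_(i < p.+1) (-1) ^+ i *
    'D_(delta_mx 0 i) (fun s => w (a + s *m F) (row' i F)) t)).
  congr cube_integral; apply/funext => t; apply: eq_bigr => i _.
  by rewrite (derive_affine (fun y => w y (row' i F))).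
rewrite cube_integral_sum; last first.
  move=> i; apply: polyfunM; first exact: polyfun_cst.
  by have [] := cube_integral_partial i (pf i).
apply: eq_bigr => i _; have [pD ID] := cube_integral_partial i (pf i).
rewrite cube_integralZ// ID.
rewrite big_bool /= expr0 expr1 mulr1 mulrN1 mulNr -mulrBr; congr (_ * (_ - _)).
  by congr cube_integral; apply/funext => t; rewrite insert_coord_mul addrA.
by congr cube_integral; apply/funext => t; rewrite insert_coord_mul addrA.
Qed.

(** The transition between two parametrizations by the cube is a signed
    permutation of the parameters; it preserves the volume of the cube, so that
    only its determinant enters the integral. *)
Lemma oriented_cell_frame p (u : set 'rV[R]_n) (o : oriented_cell p u) a
    (G : 'M[R]_(p, n)) (w : pform R n p) :
  row_free G -> row_free (oframe o) ->
  u = (fun t => a + t *m G) @` unit_cube R p ->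
  polyform w -> frame_law w ->
  exists N : 'M[R]_p, [/\ oframe o = N *m G, \det N ^+ 2 = 1 &
    cell_integral o w = (-1) ^+ osign o * \det N
      * cube_integral (fun t => w (a + t *m G) G)].
Proof.
move=> Gf Ff uG pw wl; set F := oframe o.
have imE : (fun x => obase o + x *m F) @` face_set R (full_face p)
         = (fun y => a + y *m G) @` face_set R (full_face p).
  rewrite -[RHS](_ : u = _); first exact: esym (oriented_cellE o).
  by rewrite {1}uG unit_cubeE.
have [g [e [[_ gi _] rel]]] := face_transition Ff Gf (leqnn p) imE.
have gI : injective g by move=> i j; apply: gi; rewrite ffunE.
have yE x : unit_cube R p x ->
    obase o + x *m F = a + (\row_b flip (e b) (x 0 (g b))) *m G.
  rewrite unit_cubeE => tx.
  have : ((fun x => obase o + x *m F) @` face_set R (full_face p)) (obase o + x *m F).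
    by exists x.
  rewrite imE => -[y ty yx]; rewrite -yx; congr (_ + _ *m G); apply/rowP => b.
  by rewrite mxE (rel x y tx ty (esym yx))// ffunE.
pose N : 'M[R]_p := \matrix_(i, j) ((-1) ^+ e j * (i == g j)%:R).
have FN : F = N *m G.
  apply/row_matrixP => i; rewrite row_mul.
  have := yE _ (@delta_in_cube R p i); have := yE _ (@zero_in_cube R p).
  rewrite mul0mx addr0 -rowE => -> /eqP; rewrite -addrA (inj_eq (addrI _)) => /eqP E.
  have : row i F = ((\row_b flip (e b) ((delta_mx 0 i : 'rV[R]_p) 0 (g b)))
            - \row_b flip (e b) ((0 : 'rV[R]_p) 0 (g b))) *m G.
    by rewrite mulmxBl -E addrAC subrr add0r.
  move=> ->; congr (_ *m G); apply/rowP => b; rewrite !mxE eqxx /= eq_sym.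
  by case: (e b); rewrite /flip ?expr1 ?expr0; ring.
have NE (t : 'rV[R]_p) : (\row_b flip (e b) (t 0 (g b))) = (\row_b flip (e b) 0) + t *m N.
  apply/rowP => b; rewrite !mxE (bigD1 (g b))//= mxE eqxx mulr1 big1 => [|j jb].
    by case: (e b); rewrite /flip ?expr1 ?expr0; ring.
  by rewrite mxE (negPf jb) !mulr0.
exists N; split=> //; first exact: det_signed_perm.
rewrite /cell_integral -/F -mulrA; congr (_ * _).
have pG : polyfun (fun t => w (a + t *m G) G) by exact: (polyfun_affine _ _ (pw _)).
rewrite -(cube_integral_perm (perm gI) e pG) -cube_integralZ; last first.
  have -> : (fun t : 'rV[R]_p => w (a + (\row_b flip (e b) (t 0 (perm gI b))) *m G) G)
    = (fun t => w ((a + (\row_b flip (e b) 0) *m G) + t *m (N *m G)) G).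
    apply/funext => t; under eq_mx do rewrite permE.
    by rewrite NE mulmxDl mulmxA addrA.
  exact: (polyfun_affine _ _ (pw _)).
apply: cube_integral_ext => t t01; rewrite yE// {1}FN wl.
by congr (_ * w (_ + _ *m _) _); apply/rowP => b; rewrite !mxE permE.
Qed.

Lemma facet_signE p (u u' : set 'rV[R]_n) (ou : oriented_cell p.+1 u)
    (ou' : oriented_cell p u') i b (N : 'M[R]_p) :
  row_free (oframe ou) -> oframe ou' = N *m row' i (oframe ou) ->
  \det N ^+ 2 = 1 ->
  facet_sign ou ou' i b
  = (-1) ^+ osign ou * (-1) ^+ osign ou' * ((-1) ^+ i * (-1) ^+ (~~ b) * \det N).
Proof.
move=> Ff FN N1; rewrite /facet_sign; congr (_ * _); set F := oframe ou.
set M := (X in \det X).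
have FF j l : \sum_q F j q * pinvmx F q l = (j == l)%:R.
  by have := congr1 (fun A : 'M[R]_p.+1 => A j l) (mulmxVp Ff); rewrite !mxE.
have M0 j : M ord0 j = (-1) ^+ (~~ b) * (i == j)%:R.
  rewrite -FF mulr_sumr mxE; apply: eq_bigr => q _.
  have -> : ord0 = lshift p (ord0 : 'I_1) by apply/val_inj.
  by rewrite (@col_mxEu _ 1 p n _ _ ord0 q) !mxE mulrA.
have -> : \det M = (-1) ^+ i * (-1) ^+ (~~ b) * \det N.
  rewrite (expand_det_row M ord0) (bigD1 i)//= big1 => [|j ji]; last first.
    by rewrite M0 eq_sym (negPf ji) mulr0 mul0r.
  rewrite M0 eqxx mulr1 addr0 /cofactor add0n mulrA [_ * (-1) ^+ i]mulrC.
  congr (_ * \det _); apply/matrixP => l m; rewrite !mxE.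
  have -> : lift ord0 l = rshift 1 l by apply/val_inj.
  under eq_bigr => q _ do rewrite (@col_mxEd _ 1 p n _ _ l q) FN mxE mulr_suml.
  rewrite exchange_big /= (bigD1 m)//= [X in _ + X]big1 => [|j jm].
    under eq_bigr do rewrite mxE -mulrA.
    by rewrite -mulr_sumr FF eqxx mulr1 addr0.
  under eq_bigr do rewrite mxE -mulrA.
  by rewrite -mulr_sumr FF (inj_eq (@lift_inj _ i)) (negPf jm) mulr0.
have sg_sign (s : bool) : Num.sg ((-1) ^+ s) = (-1) ^+ s :> R.
  by case: s; rewrite ?expr1 ?expr0 ?sgrN sgr1.
move/eqP: N1; rewrite sqrf_eq1 => /orP[]/eqP ->.
  by rewrite mulr1 -(signr_odd _ i) -signr_addb sg_sign.
by rewrite mulrN1 sgrN -(signr_odd _ i) -signr_addb sg_sign.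
Qed.

Lemma facetE p (u : set 'rV[R]_n) (ou : oriented_cell p.+1 u) i b :
  facet ou i b = (fun t => obase ou + b%:R *: row i (oframe ou)
                     + t *m row' i (oframe ou)) @` unit_cube R p.
Proof.
apply/seteqP; split=> [_ [t [tb t01] <-]|_ [t t01 <-]].
  exists (\row_j t 0 (lift i j)).
    by move=> j; rewrite mxE; exact: t01.
  rewrite -addrA -insert_coord_mul; congr (_ + _ *m _); apply/rowP => j.
  by rewrite mxE; case: unliftP => [j' ->|->//]; rewrite mxE.
exists (insert_coord i b%:R t).
  split=> [|j]; first by rewrite mxE unlift_none.
  by rewrite mxE; case: unliftP => [j' _|_]; [exact: t01|case: b; rewrite ?lexx ler01].
by rewrite insert_coord_mul addrA.
Qed.

Lemma row'_free p (F : 'M[R]_(p.+1, n)) i : row_free F -> row_free (row' i F).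
Proof.
move=> /row_freeP[B FB]; apply/row_freeP; exists (col' i B).
apply/matrixP => j l; have := congr1 (fun A : 'M[R]_p.+1 => A (lift i j) (lift i l)) FB.
rewrite !mxE (inj_eq (@lift_inj _ i)) => <-.
by apply: eq_bigr => q _; rewrite !mxE.
Qed.

(** The sign in the incidence number compensates the orientation of the facet. *)
Lemma facet_integral p (u u' : set 'rV[R]_n) (ou : oriented_cell p.+1 u)
    (ou' : oriented_cell p u') i b (w : pform R n p) :
  row_free (oframe ou) -> row_free (oframe ou') -> u' = facet ou i b ->
  polyform w -> frame_law w ->
  facet_sign ou ou' i b * cell_integral ou' w
  = (-1) ^+ osign ou * ((-1) ^+ i * (-1) ^+ (~~ b) *
      cube_integral (fun t => w (obase ou + b%:R *: row i (oframe ou)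
        + t *m row' i (oframe ou)) (row' i (oframe ou)))).
Proof.
move=> Ff Ff' uf pw wl; rewrite facetE in uf.
have [N [FN N1 ->]] := oriented_cell_frame (row'_free i Ff) Ff' uf pw wl.
rewrite (facet_signE b Ff FN N1); set I := cube_integral _.
have s1 : (-1) ^+ osign ou' * (-1) ^+ osign ou' = 1 :> R.
  by rewrite -expr2 sqrr_sign.
transitivity ((-1) ^+ osign ou * ((-1) ^+ i * (-1) ^+ (~~ b) * I)
  * ((-1) ^+ osign ou' * (-1) ^+ osign ou') * \det N ^+ 2); first by ring.
by rewrite s1 N1 !mulr1.
Qed.

End Stokes.

Section SmallCubeStokes.
Variables (R : realType) (n k : nat).
Hypothesis k_gt0 : (0 < k)%N.

(** Fixing a parameter of the cell fixes one local coordinate of the small cube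
    at one of its two ends. *)
Lemma facet_small_cube (A : 'M[R]_n) b p (c : small_index n k p.+1) u
    (o : oriented_cell p.+1 u) l (s : bool) :
  A \in unitmx -> u = affine_map A b @` small_cube R c ->
  exists d : small_index n k p, facet o l s = affine_map A b @` small_cube R d.
Proof.
move=> Au uE; have imE := param_image o uE.
have A'u := scaled_unit k_gt0 Au; have Ff := oframe_free k_gt0 Au o uE.
have A'f : row_free (k%:R^-1 *: A) by rewrite row_free_unit.
have [g [e [[gf gi _] rel]]] :=
  face_transition A'f Ff (leq_dim c) (esym imE).
pose tau : cface n := [ffun m => if m == g l then Some (e l (+) s) else val c.2 m].
have gN m : val c.2 (g m) = None by apply: gf; rewrite ffunE.
have tau_p : #|free_coords tau| == p.
  have := valP c.2; rewrite (cardsD1 (g l)) inE gN eqxx add1n eqSS.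
  have -> // : (free_coords (val c.2) :\ g l)%SET = free_coords tau.
  by apply/setP => m; rewrite !inE ffunE; case: eqVneq.
have tau_sub x : face_set R tau x <->
    face_set R (val c.2) x /\ x 0 (g l) = (e l (+) s)%:R.
  split=> [tx|[tx xg] m]; last first.
    by rewrite ffunE; case: eqVneq => [->//|_]; exact: tx.
  split=> [m|]; last by have := tx (g l); rewrite ffunE eqxx.
  have := tx m; rewrite ffunE; case: eqVneq => [-> ->|//]; rewrite gN.
  by case: addb; rewrite ?lexx ler01.
exists (c.1, Sub tau tau_p).
rewrite [RHS](@small_image R n k A b p (c.1, Sub tau tau_p) _ erefl) SubK /facet.
apply/seteqP; split=> [_ [t [tl t01] <-]|_ [x /tau_sub[tx xg] <-]].
  have ut : face_set R (full_face p.+1) t by rewrite -unit_cubeE.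
  have : ((fun t => obase o + t *m oframe o) @` face_set R (full_face p.+1))
     (obase o + t *m oframe o) by exists t.
  rewrite imE => -[x tx xt]; exists x => //; apply/tau_sub; split=> //.
  have := rel x t tx ut xt l; rewrite ffunE tl => /(_ erefl) /(congr1 (flip (e l))).
  by rewrite flipK flip_natr.
have : ((fun x => b + (k%:R^-1 *: \row_l (c.1 l)%:R) *m A + x *m (k%:R^-1 *: A))
         @` face_set R (val c.2))
       (b + (k%:R^-1 *: \row_l (c.1 l)%:R) *m A + x *m (k%:R^-1 *: A)) by exists x.
rewrite -imE => -[t ut tx']; exists t => //; split; last by rewrite unit_cubeE.
by rewrite (rel x t tx ut (esym tx')) ?ffunE// xg flip_natr addbA addbb.
Qed.

Lemma frame_law_cube_form p (c : small_index n k p) : frame_law (cube_form R c).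
Proof.
move=> x N G; rewrite !cube_formE// -mulmx_colsub det_mulmx.
by rewrite mulrCA.
Qed.

Lemma frame_law_pullback A b p (w : pform R n p) :
  frame_law w -> frame_law (pullback_inv A b w).
Proof. by move=> wl x N G; rewrite /pullback_inv -mulmxA wl. Qed.

Lemma frame_law_sum p (I : Type) (r : seq I) (a : I -> R) (w : I -> pform R n p) :
  (forall i, frame_law (w i)) -> frame_law (fun x v => \sum_(i <- r) a i * w i x v).
Proof.
move=> wl x N G; rewrite mulr_sumr; apply: eq_bigr => i _.
by rewrite wl mulrCA.
Qed.

(** * The exterior derivative of a cubical form *)

Definition cube_span p (w : pform R n p) : Prop :=
  exists r : seq (R * small_index n k p),
    w = fun x v => \sum_(q <- r) q.1 * cube_form R q.2 x v.

Lemma cube_span_sum p (I : Type) (r : seq I) (a : I -> R) (w : I -> pform R n p) :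
  (forall i, cube_span (w i)) ->
  cube_span (fun x v => \sum_(i <- r) a i * w i x v).
Proof.
move=> sw; elim: r => [|i r [s sE]].
  by exists [::]; apply/funext => x; apply/funext => v; rewrite !big_nil.
have [t tE] := sw i; exists ([seq (a i * q.1, q.2) | q <- t] ++ s).
apply/funext => x; apply/funext => v; rewrite big_cons big_cat big_map /=.
have -> : \sum_(j <- r) a j * w j x v = \sum_(q <- s) q.1 * cube_form R q.2 x v.
  by have := congr1 (fun f => f x v) sE.
congr (_ + _); rewrite tE mulr_sumr; apply: eq_bigr => q _.
by rewrite mulrA.
Qed.

Lemma cube_span_form p (c : small_index n k p) : cube_span (cube_form R c).
Proof.
exists [:: (1, c)]; apply/funext => x; apply/funext => v.
by rewrite big_seq1 mul1r.
Qed.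

Lemma cube_spanZ p a (w : pform R n p) :
  cube_span w -> cube_span (fun x v => a * w x v).
Proof.
move=> sw; have := @cube_span_sum p unit [:: tt] (fun=> a) (fun=> w) (fun=> sw).
by congr cube_span; apply/funext => x; apply/funext => v; rewrite big_seq1.
Qed.

Lemma deriv_prod_seq (I : eqType) (r : seq I) (P : I -> {poly R}) : uniq r ->
  (\prod_(m <- r) P m)^`()
  = \sum_(l <- r) \prod_(m <- r) (if m == l then (P m)^`() else P m).
Proof.
elim: r => [|l r IH] /=; first by rewrite !big_nil derivC.
move=> /andP[lr ru]; rewrite big_cons derivM IH// [RHS]big_cons; congr (_ + _).
  rewrite big_cons eqxx; congr (_ * _); apply: eq_big_seq => m mr.
  by case: eqVneq => // ml; rewrite -ml mr in lr.
rewrite mulr_sumr; apply: eq_big_seq => m mr; rewrite big_cons.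
by case: eqVneq => // lm; rewrite lm mr in lr.
Qed.

Lemma derive_prod (P : 'I_n -> {poly R}) a (x v : 'rV[R]_n) :
  'D_v (fun y : 'rV[R]_n => (\prod_l (P l).[y 0 l]) * a) x
  = \sum_l v 0 l * (\prod_m (if m == l then (P m)^`() else P m).[x 0 m]) * a.
Proof.
rewrite (derive_line (q := a *: \prod_l (P l \Po (v 0 l *: 'X + (x 0 l)%:P)))).
  rewrite derivZ hornerZ deriv_prod_seq ?index_enum_uniq// horner_sum mulr_sumr.
  apply: eq_bigr => l _; rewrite mulrC horner_prod; congr (_ * _).
  rewrite (bigD1 l)//= eqxx [in RHS](bigD1 l)//= eqxx mulrA; congr (_ * _).
    rewrite deriv_comp hornerM horner_comp derivD derivZ derivX derivC.
    rewrite !(hornerD, hornerZ, hornerC, hornerX) mulr0 add0r addr0.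
    by rewrite mulr1 mulrC.
  apply: eq_bigr => m /negPf ml; rewrite ml horner_comp.
  by rewrite !(hornerD, hornerZ, hornerC, hornerX) mulr0 add0r.
move=> h; rewrite hornerZ mulrC horner_prod; congr (_ * _).
apply: eq_bigr => l _; by rewrite horner_comp hornerD hornerZ hornerX hornerC !mxE mulrC.
Qed.

(** The two intervals are the ones adjacent to the point; at an end of [0,1] one
    coefficient vanishes and its interval is arbitrary. *)
Lemma deriv_bern_point (m : 'I_k.+1) : exists a1 a2 : R, exists j1 j2 : 'I_k,
  (bern R (inl m))^`() = a1 *: bern R (inr j1) + a2 *: bern R (inr j2).
Proof.
have mk := ltn_ord m.
have [j1 j1E] : exists j1 : 'I_k, (0 < m)%N -> j1 = m.-1 :> nat.
  case: (posnP m) => m0; first by exists (Ordinal k_gt0).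
  have m1k : (m.-1 < k)%N by lia.
  by exists (Ordinal m1k).
have [j2 j2E] : exists j2 : 'I_k, (m < k)%N -> j2 = m :> nat.
  case: (ltnP m k) => mk'; last by exists (Ordinal k_gt0).
  by exists (Ordinal mk').
exists m%:R, (- (k - m)%:R), j1, j2.
rewrite /bern /bpoly /= derivM derivXn deriv_exp derivB derivX -polyC1 derivC.
rewrite sub0r polyC1 mulN1r mulNrn mulrN scaleNr; congr (_ - _).
  rewrite mulrnAl -scaler_nat; case: (posnP m) => [->|m0]; first by rewrite !scale0r.
  by rewrite j1E//; congr (_ *: (_ * _ ^+ _)); lia.
rewrite mulrnAr -scaler_nat; case: (ltnP m k) => km; last first.
  by rewrite (eqP km) !scale0r.
by rewrite j2E//; congr (_ *: (_ * _ ^+ _)); lia.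
Qed.

Lemma det_colsub_reindex p (f h : 'I_p -> 'I_n) (q : 'I_p -> 'I_p) :
  (forall j, f (q j) = h j) ->
  exists s : R, forall v : 'M[R]_(p, n), \det (colsub h v) = s * \det (colsub f v).
Proof.
move=> fq; pose S : 'M[R]_p := \matrix_(i, j) (i == q j)%:R.
exists (\det S) => v; rewrite mulrC -det_mulmx; congr (\det _).
apply/matrixP => i j; rewrite !mxE (bigD1 (q j))//= !mxE eqxx mulr1 fq.
by rewrite big1 ?addr0// => l lj; rewrite !mxE (negPf lj) mulr0.
Qed.

(** Differentiating in a direction [l] in which the small cube is a point turns its
    Bernstein polynomial into two polynomials of intervals, and dx_l becomes a new
    free direction; the other directions contribute nothing. *)
Lemma exterior_cube_form p (c : small_index n k p) :
  cube_span (exterior_derivative (cube_form R c)).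
Proof.
pose P l := bern R (box_of c l).
pose dP l (x : 'rV[R]_n) := \prod_m (if m == l then (P m)^`() else P m).[x 0 m].
pose f := free_coord c.2.
pose fl l (j : 'I_p.+1) := if unlift ord0 j is Some j' then f j' else l.
have -> : exterior_derivative (cube_form R c)
    = fun x v => \sum_l 1 * (dP l x * \det (colsub (fl l) v)).
  apply/funext => x; apply/funext => v.
  rewrite /exterior_derivative.
  under eq_bigr => i _.
    rewrite (_ : (fun y => _) = fun y : 'rV[R]_n => (\prod_l (P l).[y 0 l])
         * \det (colsub f (row' i v))); last first.
      by apply/funext => y; rewrite cube_formE.
    rewrite derive_prod mulr_sumr; over.
  rewrite exchange_big; apply: eq_bigr => l _; rewrite mul1r.
  rewrite (expand_det_col _ ord0) mulr_sumr; apply: eq_bigr => i _.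
  rewrite /cofactor addn0 !mxE /fl unlift_none.
  have -> : row' i (col' ord0 (colsub (fl l) v)) = colsub f (row' i v).
    by apply/matrixP => a d; rewrite !mxE /fl liftK.
  by rewrite /dP; ring.
apply: cube_span_sum => l.
case E: (box_of c l) => [m|m]; last first.
  (* [dx_l] already occurs in the form *)
  have lN : val c.2 l = None.
    by move: E; rewrite ffunE; case: (val c.2 l).
  have [j fj] := free_coord_onto lN.
  exists [::]; apply/funext => x; apply/funext => v; rewrite big_nil -det_tr.
  rewrite (determinant_alternate (i1 := ord0) (i2 := lift ord0 j)) ?mulr0//.
  by move=> i; rewrite !mxE /fl unlift_none liftK /f fj.
have lN : val c.2 l != None by move: E; rewrite ffunE; case: (val c.2 l).
have [a1 [a2 [j1 [j2 dE]]]] := deriv_bern_point m.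
have step (j : 'I_k) : cube_span (fun x v =>
    (\prod_q (if q == l then bern R (inr j) else P q).[x 0 q]) * \det (colsub (fl l) v)).
  pose B : box n k := [ffun q => if q == l then inr j else box_of c q].
  have B_free : box_free B = (l |: free_coords (val c.2))%SET.
    apply/setP => q; rewrite -box_free_of !inE !ffunE; case: eqVneq => //.
  have Bp : #|box_free B| = p.+1.
    by rewrite B_free cardsU1 inE lN (eqP (valP c.2)).
  have [d dB] := box_ofP k_gt0 Bp.
  have dfree q : val d.2 q = None -> q = l \/ val c.2 q = None.
    move=> qN; have : q \in box_free B by rewrite -dB box_free_of inE qN.
    by rewrite B_free !inE => /orP[/eqP|/eqP]; auto.
  have freed q : q = l \/ val c.2 q = None -> val d.2 q = None.
    move=> qlc; apply/eqP; have : q \in box_free B.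
      by rewrite B_free !inE; case: qlc => ->; rewrite eqxx ?orbT.
    by rewrite -dB box_free_of inE.
  have /choice[q qE] (i : 'I_p.+1) : exists a, free_coord d.2 a = fl l i.
    apply: free_coord_onto; apply: freed; rewrite /fl.
    by case: unlift => [i'|]; [right; exact: free_coord_free|left].
  have [s sE] := det_colsub_reindex qE.
  have := cube_spanZ s (cube_span_form d); congr cube_span.
  apply/funext => x; apply/funext => v; rewrite sE cube_formE// mulrCA.
  congr (_ * _); apply: eq_bigr => q' _; rewrite dB ffunE.
  by case: eqVneq.
have := @cube_span_sum p.+1 bool [:: true; false] (fun b => if b then a1 else a2) _
  (fun b : bool => step (if b then j1 else j2)).
congr cube_span; apply/funext => x; apply/funext => v.
rewrite big_cons big_seq1 /= !mulrA -mulrDl; congr (_ * _).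
rewrite /dP (bigD1 l)//= [in X in _ + X](bigD1 l)//= [in RHS](bigD1 l)//= !eqxx.
rewrite [P l]/(bern _ _) E dE hornerD !hornerZ mulrDl !mulrA.
by congr (_ * _ + _ * _); apply: eq_bigr => q /negPf ->.
Qed.

Lemma derive_pullback A b (f : 'rV[R]_n -> R) (x v : 'rV[R]_n) :
  'D_v (fun y => f ((y - b) *m invmx A)) x
  = 'D_(v *m invmx A) f ((x - b) *m invmx A).
Proof.
rewrite /derive.
suff -> : (fun h => h^-1 *: (((fun y => f ((y - b) *m invmx A)) \o shift x) (h *: v)
                          - f ((x - b) *m invmx A)))
  = (fun h => h^-1 *: ((f \o shift ((x - b) *m invmx A)) (h *: (v *m invmx A))
                      - f ((x - b) *m invmx A))) by [].
apply/funext => h /=; congr (_ *: (f _ - _)).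
by rewrite -addrA mulmxDl -scalemxAl.
Qed.

Lemma exterior_pullback A b p (w : pform R n p) :
  exterior_derivative (pullback_inv A b w)
  = pullback_inv A b (exterior_derivative w).
Proof.
apply/funext => x; apply/funext => v; apply: eq_bigr => i _; congr (_ * _).
rewrite /pullback_inv (derive_pullback _ _ (fun y => w y (row' i v *m invmx A))).
by rewrite row_mul; congr ('D_ _ _ _); apply/funext => y;
  congr (w _ _); apply/matrixP => a c; rewrite !mxE; apply: eq_bigr => q _; rewrite mxE.
Qed.

Lemma polyfun_line (f : 'rV[R]_n -> R) x v : polyfun f ->
  exists q : {poly R}, forall h, f (h *: v + x) = q.[h].
Proof.
move=> [s ->].
exists (\sum_(q <- s) q.1 *: \prod_j (q.2 j \Po (v 0 j *: 'X + (x 0 j)%:P))) => h.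
rewrite horner_sum; apply: eq_bigr => q _; rewrite hornerZ horner_prod.
congr (_ * _); apply: eq_bigr => j _.
by rewrite horner_comp hornerD hornerZ hornerX hornerC !mxE mulrC.
Qed.

Lemma derive_polyfun_sum (I : Type) (r : seq I) (a : I -> R)
    (F : I -> 'rV[R]_n -> R) x v : (forall i, polyfun (F i)) ->
  'D_v (fun y => \sum_(i <- r) a i * F i y) x = \sum_(i <- r) a i * 'D_v (F i) x.
Proof.
move=> pF; have /choice[q qE] i := polyfun_line x v (pF i).
rewrite (derive_line (q := \sum_(i <- r) a i *: q i)); last first.
  by move=> h; rewrite horner_sum; apply: eq_bigr => i _; rewrite hornerZ qE.
rewrite raddf_sum horner_sum; apply: eq_bigr => i _ /=.
by rewrite derivZ hornerZ (derive_line (qE i)).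
Qed.

Lemma exterior_sum p (I : Type) (r : seq I) (a : I -> R) (w : I -> pform R n p) :
  (forall i, polyform (w i)) ->
  exterior_derivative (fun x v => \sum_(i <- r) a i * w i x v)
  = fun x v => \sum_(i <- r) a i * exterior_derivative (w i) x v.
Proof.
move=> pw; apply/funext => x; apply/funext => v.
rewrite /exterior_derivative; under eq_bigr => i _.
  rewrite (derive_polyfun_sum r a x (row i v) (fun j => pw j (row' i v))) mulr_sumr.
  over.
rewrite exchange_big; apply: eq_bigr => j _; rewrite mulr_sumr.
by apply: eq_bigr => i _; rewrite mulrCA.
Qed.

Lemma exterior_cube_span p (w : pform R n p) :
  cube_span w -> cube_span (exterior_derivative w).
Proof.
move=> [r ->]; rewrite exterior_sum; last by move=> q; exact: polyform_cube_form.
by apply: cube_span_sum => q; exact: exterior_cube_form.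
Qed.

End SmallCubeStokes.

(** * The interpolation operator *)

Section Interpolation.
Variables (R : realType) (n : nat) (Omega : set 'rV[R]_n).
Variables (K : cubical_mesh Omega) (k : nat) (o : orientation K k).
Hypothesis k_gt0 : (0 < k)%N.
Implicit Types i j : mcells K.

Definition small_cell i p (c : small_index n k p) : Kk_cells K k p :=
  exist (fun u => u \in Kk_cells K k p) (msmall_cube i c)
    (mem_set (ex_intro _ i (ex_intro _ c erefl))).

Lemma KkP p (u : Kk_cells K k p) : exists i c, u = small_cell i c.
Proof.
case: u => u uK; have := set_mem uK => -[i [c uE]]; exists i, c.
exact: val_inj.
Qed.

(** The restrictions of cubical forms to one n-cell. *)
Definition local_form i p (w : pform R n p) : Prop :=
  exists2 v, cube_span k v & w = pullback_inv (mlin i) (mtrans i) v.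

Lemma local_form_sum i p (I : Type) (r : seq I) (a : I -> R)
    (w : I -> pform R n p) : (forall q, local_form i (w q)) ->
  local_form i (fun x v => \sum_(q <- r) a q * w q x v).
Proof.
move=> wl; have /choice[v vP] q : exists v, cube_span k v /\
    w q = pullback_inv (mlin i) (mtrans i) v.
  by have [v ? ?] := wl q; exists v.
exists (fun x y => \sum_(q <- r) a q * v q x y).
  by apply: cube_span_sum => q; have [] := vP q.
apply/funext => x; apply/funext => y; rewrite /pullback_inv.
by apply: eq_bigr => q _; have [_ ->] := vP q.
Qed.

Lemma local_w_form p (u : Kk_cells K k p) i : local_form i (w_form o u i).
Proof.
have [ui|ui] := pselect (val u `<=` mcell i).
  have [c uc] := subset_msmall k_gt0 ui; rewrite (w_formE o k_gt0 uc) /=.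
  set a := Num.sg _; exists (fun x v => a * cube_form R c x v) => //.
  by apply: cube_spanZ; exact: cube_span_form.
exists (fun _ _ => 0); last by rewrite w_form0.
exists [::]; apply/funext => x; apply/funext => v; by rewrite big_nil.
Qed.

Lemma local_cubical p (w : pwform K p) i : cubical_forms o w -> local_form i (w i).
Proof.
move=> [s [a ->]]; apply: (local_form_sum s a (w := fun u => w_form o u i)) => u.
exact: local_w_form.
Qed.

Lemma polyform_span p (v : pform R n p) : cube_span k v -> polyform v.
Proof. by move=> [r ->]; apply: polyform_sum => q; exact: polyform_cube_form. Qed.

Lemma polyform_local i p (w : pform R n p) : local_form i w -> polyform w.
Proof. by move=> [v vs ->]; apply: polyform_pullback; exact: polyform_span. Qed.

Lemma frame_law_local i p (w : pform R n p) : local_form i w -> frame_law w.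
Proof.
move=> [v [r ->] ->]; apply: frame_law_pullback; apply: frame_law_sum => q.
exact: frame_law_cube_form.
Qed.

Lemma local_exterior i p (w : pform R n p) :
  local_form i w -> local_form i (exterior_derivative w).
Proof.
move=> [v vs ->]; exists (exterior_derivative v); first exact: exterior_cube_span.
exact: exterior_pullback.
Qed.

Lemma local_unique i p (w w' : pform R n p) : local_form i w -> local_form i w' ->
  (forall c : small_index n k p,
     cell_integral (o (small_cell i c)) w = cell_integral (o (small_cell i c)) w') ->
  w = w'.
Proof.
move=> wl wl' ww'.
pose sg (b : bool) : R := if b then 1 else -1.
pose f (b : bool) := if b then w else w'.
have fl b : local_form i (f b) by case: b.
have [v [r vE] dE] := local_form_sum [:: true; false] sg fl.
have diff x y : \sum_(b <- [:: true; false]) sg b * f b x y = w x y - w' x y.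
  by rewrite big_cons big_seq1 /= mul1r mulN1r.
apply/funext => x; apply/funext => y; apply/eqP; rewrite -subr_eq0 -diff.
have -> : \sum_(b <- [:: true; false]) sg b * f b x y
    = pullback_inv (mlin i) (mtrans i) v x y.
  by have := congr1 (fun h => h x y) dE.
rewrite vE /pullback_inv; apply/eqP.
apply: (@cube_form_sum0 R n k k_gt0 (mlin i) (mtrans i) p _ r fst snd
          (fun d => o (small_cell i d)) (mlin_unit i)) => d.
rewrite -vE -dE cell_integral_sum; last by move=> b; exact: polyform_local (fl b).
by rewrite big_cons big_seq1 /= ww' mul1r mulN1r subrr.
Qed.

Lemma small_cell_sub i p (c : small_index n k p) : val (small_cell i c) `<=` mcell i.
Proof. exact: (msmall_cube_sub k_gt0). Qed.

Lemma cubical_unique p (w w' : pwform K p) : cubical_forms o w -> cubical_forms o w' ->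
  de_Rham o w = de_Rham o w' -> w = w'.
Proof.
move=> wQ wQ' ww'; apply/funext => i.
apply: local_unique; [exact: local_cubical..|] => c.
have := congr1 (fun X => X (small_cell i c)) ww'.
rewrite (de_RhamE k_gt0 wQ (@small_cell_sub i p c)).
by rewrite (de_RhamE k_gt0 wQ' (@small_cell_sub i p c)).
Qed.

Lemma cubical_w_sum p (s : seq (Kk_cells K k p)) (a : Kk_cells K k p -> R) :
  cubical_forms o (fun i x v => \sum_(u <- s) a u * w_form o u i x v).
Proof. by exists s, a. Qed.

Lemma cubical_w_form p (u : Kk_cells K k p) : cubical_forms o (w_form o u).
Proof.
exists [:: u], (fun=> 1); apply/funext => i; apply/funext => x; apply/funext => v.
by rewrite big_seq1 mul1r.
Qed.

Lemma de_Rham_sum p (s : seq (Kk_cells K k p)) (a : Kk_cells K k p -> R) u :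
  de_Rham o (fun i x v => \sum_(u' <- s) a u' * w_form o u' i x v) u
  = \sum_(u' <- s) a u' * de_Rham o (w_form o u') u.
Proof.
have [i [c ->]] := KkP u; have ui := @small_cell_sub i p c.
rewrite (de_RhamE k_gt0 (cubical_w_sum s a) ui) cell_integral_sum.
  apply: eq_bigr => u' _; rewrite (de_RhamE k_gt0 _ ui)//.
  exact: cubical_w_form.
by move=> u'; exact: polyform_local (local_w_form u' i).
Qed.

Lemma box_small_cube p (c d : small_index n k p) :
  box_of c = box_of d -> small_cube R c = small_cube R d.
Proof.
move=> cd; apply/seteqP; split=> x /(small_cubeP k_gt0) xP; apply/(small_cubeP k_gt0).
  by rewrite -cd.
by rewrite cd.
Qed.

(** Each cell lies in some n-cell, where the combination is a local form and
    [cube_form_coef] isolates the coefficient of that cell. *)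
Lemma w_form_indep p (s : seq (Kk_cells K k p)) (a : Kk_cells K k p -> R) :
  uniq s ->
  (forall u, de_Rham o (fun i x v => \sum_(u <- s) a u * w_form o u i x v) u = 0) ->
  forall u, u \in s -> a u = 0.
Proof.
move=> s_uniq int0 u0 u0s; have [i [c0 u0E]] := KkP u0.
have /choice[c cP] (u : Kk_cells K k p) : exists c : small_index n k p,
    val u `<=` mcell i -> val u = msmall_cube i c.
  have [ui|ui] := pselect (val u `<=` mcell i); last by exists c0.
  by have [c uc] := subset_msmall k_gt0 ui; exists c.
pose s' := [seq u <- s | `[< val u `<=` mcell i >]].
pose a' u := a u * Num.sg (cell_integral (o u)
   (pullback_inv (mlin i) (mtrans i) (cube_form R (c u)))).
have wE : (fun x v => \sum_(u <- s) a u * w_form o u i x v)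
  = pullback_inv (mlin i) (mtrans i)
      (fun x v => \sum_(u <- s') a' u * cube_form R (c u) x v).
  apply/funext => x; apply/funext => v; rewrite pullback_inv_sum big_filter.
  rewrite [LHS](bigID (fun u => `[< val u `<=` mcell i >])) /= [X in _ + X]big1 ?addr0.
    apply: eq_bigr => u /asboolP ui.
    by rewrite (w_formE o k_gt0 (cP u ui)) /= mulrA.
  by move=> u /asboolPn ui; rewrite w_form0 ?mulr0.
have coef0 := @cube_form_coef R n k k_gt0 (mlin i) (mtrans i) p _ s' a' c
  (fun d => o (small_cell i d)) (mlin_unit i).
have {}coef0 := coef0 _ (box_of c0).
have u0i : val u0 `<=` mcell i by rewrite u0E; exact: small_cell_sub.
have {coef0} : \sum_(u <- s' | box_of (c u) == box_of c0) a' u = 0.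
  apply: coef0 => d; rewrite -wE.
  by rewrite -(de_RhamE k_gt0 (cubical_w_sum s a) (@small_cell_sub i p d)) int0.
rewrite -big_filter.
have -> : [seq u <- s' | box_of (c u) == box_of c0] = [:: u0].
  have u0s' : u0 \in s' by rewrite mem_filter u0s andbT; apply/asboolP.
  rewrite -(filter_pred1_uniq (filter_uniq _ s_uniq) u0s').
  apply: eq_in_filter => u; rewrite mem_filter => /andP[/asboolP ui _].
  apply/eqP/eqP => [cu|->]; last first.
    by apply: (@msmall_cube_box _ _ _ K k k_gt0 i); rewrite -(cP u0 u0i) u0E.
  apply/val_inj; rewrite /= (cP u ui) u0E /=.
  by rewrite /msmall_cube (box_small_cube cu).
rewrite big_seq1 => /eqP; rewrite mulf_eq0 sgr_eq0.
rewrite (negPf (cell_integral_self_neq0 k_gt0 (o u0) (mlin_unit i) (cP u0 u0i))) orbF.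
by move/eqP.
Qed.

Lemma all_cells p : exists2 s : seq (Kk_cells K k p), uniq s & forall u, u \in s.
Proof.
exists (undup [seq small_cell ic.1 ic.2 | ic <- enum {: mcells K * small_index n k p}]).
  exact: undup_uniq.
move=> u; rewrite mem_undup; have [i [c ->]] := KkP u.
by apply/mapP; exists (i, c) => //; rewrite mem_enum.
Qed.

(** The matrix of the integrals of the w(u) is square with trivial kernel. *)
Lemma interpolation_exists p (X : cochain K k p) :
  exists w, cubical_forms o w /\ forall u, de_Rham o w u = X u.
Proof.
have [s s_uniq s_all] := all_cells p.
have idx u : (index u s < size s)%N by rewrite index_mem.
pose num u := Ordinal (idx u); pose cell b := tnth (in_tuple s) b.
have cellK u : cell (num u) = u by rewrite /cell (tnth_nth u) nth_index.
have numK b : num (cell b) = b.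
  by apply/val_inj; rewrite /= /cell (tnth_nth (cell b)) index_uniq.
pose M := \matrix_(a, b) de_Rham o (w_form o (cell a)) (cell b).
have MP (v : 'rV[R]_(size s)) u :
    de_Rham o (fun i x y => \sum_(u' <- s) v 0 (num u') * w_form o u' i x y) u
    = (v *m M) 0 (num u).
  rewrite de_Rham_sum big_tnth mxE; apply: eq_bigr => b _.
  by rewrite -/(cell b) numK mxE cellK.
have Mu : M \in unitmx.
  apply: unitmx_inj => v v0; apply/rowP => b; rewrite [RHS]mxE -(numK b).
  apply: (w_form_indep (a := fun u => v 0 (num u)) s_uniq) => // u.
  by rewrite MP v0 mxE.
pose v := (\row_b X (cell b)) *m invmx M.
exists (fun i x y => \sum_(u <- s) v 0 (num u) * w_form o u i x y).
split=> [|u]; first by exists s, (fun u => v 0 (num u)).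
by rewrite MP mulmxKV// mxE cellK.
Qed.

Lemma interpolationP p (X : cochain K k p) :
  cubical_forms o (interpolation o X) /\ de_Rham o (interpolation o X) = X.
Proof.
have [wQ wX] := xgetPex (fun _ _ _ => 0 : R) (interpolation_exists X).
by split=> //; apply/funext.
Qed.

Lemma facet_cells i p (c : small_index n k p.+1) :
  exists f : 'I_p.+1 -> bool -> Kk_cells K k p,
    forall l b, val (f l b) = facet (o (small_cell i c)) l b /\
                exists d, f l b = small_cell i d.
Proof.
have /choice[d dP] (lb : 'I_p.+1 * bool) : exists d : small_index n k p,
    facet (o (small_cell i c)) lb.1 lb.2 = msmall_cube i d.
  exact: (facet_small_cube k_gt0 _ _ _ (mlin_unit i) erefl).
exists (fun l b => small_cell i (d (l, b))) => l b.
by split; [rewrite (dP (l, b))|exists (d (l, b))].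
Qed.

Lemma coboundaryE p (X : cochain K k p) (u : Kk_cells K k p.+1)
    (f : 'I_p.+1 -> bool -> Kk_cells K k p) :
  (forall l b, val (f l b) = facet (o u) l b) ->
  coboundary o X u
  = \sum_(l < p.+1) \sum_(b : bool) facet_sign (o u) (o (f l b)) l b * X (f l b).
Proof.
move=> fP; have [s s_uniq s_all] := all_cells p.
have -> : coboundary o X u = \sum_(u' <- s) incidence o u u' * X u'.
  rewrite /coboundary [RHS]fsbig_seq//; apply: eq_fsbigl.
  by apply/seteqP; split=> u' //= _; exact: s_all.
rewrite /incidence; under eq_bigr do rewrite mulr_suml.
rewrite exchange_big; apply: eq_bigr => l _ /=.
under eq_bigr do rewrite mulr_suml.
rewrite exchange_big; apply: eq_bigr => b _ /=.
rewrite (bigD1_seq (f l b)) ?s_all//= (asboolT (fP l b)) big1 ?addr0// => u' u'f.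
case: ifPn => [/asboolP u'E|]; last by rewrite mul0r.
by case/eqP: u'f; apply/val_inj; rewrite /= u'E fP.
Qed.

(** The facets of the cell are small cubes of the same n-cell, so that a single
    local form is integrated on both sides. *)
Lemma stokes i p (c : small_index n k p.+1) (w : pform R n p)
    (f : 'I_p.+1 -> bool -> Kk_cells K k p) :
  local_form i w ->
  (forall l b, val (f l b) = facet (o (small_cell i c)) l b /\
               exists d, f l b = small_cell i d) ->
  cell_integral (o (small_cell i c)) (exterior_derivative w)
  = \sum_(l < p.+1) \sum_(b : bool)
      facet_sign (o (small_cell i c)) (o (f l b)) l b * cell_integral (o (f l b)) w.
Proof.
move=> wl fP; have pw := polyform_local wl; have fw := frame_law_local wl.
have free q (d : small_index n k q) : row_free (oframe (o (small_cell i d))).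
  exact: (oframe_free k_gt0 (mlin_unit i) (o (small_cell i d)) erefl).
rewrite /cell_integral (cube_stokes _ _ pw) mulr_sumr; apply: eq_bigr => l _.
rewrite mulr_sumr; apply: eq_bigr => b _; have [fE [d fd]] := fP l b.
apply/esym; apply: facet_integral => //.
by rewrite fd.
Qed.

(** Both sides are local forms on each n-cell, and Stokes' theorem gives them the
    same integrals. *)
Lemma interpolation_coboundary p (X : cochain K k p) :
  interpolation o (coboundary o X) = pw_derivative (interpolation o X).
Proof.
have [wQ wX] := interpolationP X; have [WQ WX] := interpolationP (coboundary o X).
set w := interpolation o X in wQ wX *.
apply/funext => i; apply: local_unique; first exact: local_cubical.
  by apply: local_exterior; exact: local_cubical.
move=> c; have [f fP] := facet_cells i c.
rewrite -(de_RhamE k_gt0 WQ (@small_cell_sub i p.+1 c)) WX.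
rewrite (stokes (local_cubical i wQ) fP) (coboundaryE X (f := f)); last first.
  by move=> l b; have [] := fP l b.
apply: eq_bigr => l _; apply: eq_bigr => b _; congr (_ * _).
have [_ [d fd]] := fP l b; rewrite -(de_RhamE k_gt0 wQ) ?wX//.
by rewrite fd; exact: small_cell_sub.
Qed.

End Interpolation.

Theorem proposition4p1 (R : realType) (n : nat) (Omega : set 'rV[R]_n)
    (K : cubical_mesh Omega) (k : nat) (o : orientation K k) (p : nat) :
  (1 <= k)%N -> (p <= n)%N ->
  (forall X : cochain K k p,
     exists! w : pwform K p,
       cubical_forms o w /\ forall u : Kk_cells K k p, de_Rham o w u = X u) /\
  (forall X : cochain K k p, de_Rham o (interpolation o X) = X) /\
  (forall w : pwform K p,
     cubical_forms o w -> interpolation o (de_Rham o w) = w) /\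
  (forall X : cochain K k p,
     interpolation o (coboundary o X) = pw_derivative (interpolation o X)).
Proof.
move=> k_gt0 _; have IP := interpolationP o k_gt0; split; last split; last split.
- move=> X; have [wQ wX] := IP p X; exists (interpolation o X).
  split; first by split=> // u; rewrite wX.
  move=> w [wQ' wX']; apply: (cubical_unique k_gt0 wQ wQ').
  by rewrite wX; apply/esym/funext.
- by move=> X; have [] := IP p X.
- move=> w wQ; have [wQ' wX] := IP p (de_Rham o w).
  exact: (cubical_unique k_gt0 wQ' wQ).
- exact: interpolation_coboundary.
Qed.
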